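(* Let $X=V(Q_1,Q_2,Q_3)\subset\mathbb{P}^5$ be a K3 surface of degree eight over $\mathbb{Q}$, given as a complete intersection of three quadrics, and let $S\subseteq\mathbb{P}(1,1,1,3)$ be the associated K3 surface of degree two over $\mathbb{Q}$ together with its associated class $\alpha\in\mathrm{Br}(S)$. Suppose that $S(\mathbb{R})\neq\emptyset$. Then there exists a point $P\in S(\mathbb{R})$ such that $\mathrm{inv}_\infty(\alpha(P))=0$.
   Context: Let $M_i$ be the symmetric Gram matrix of $Q_i$ ($i=1,2,3$) and $M(x,y,z)=xM_1+yM_2+zM_3$. The associated surface is $$S=\{w^2=-\det M(x,y,z)\}\subset\mathbb{P}(1,1,1,3)=\mathrm{Proj}\,\mathbb{Q}[x,y,z,w],$$ assumed to be a (smooth) K3 surface; it is the discriminant double cover $S\to\mathbb{P}^2$ of the net of quadrics $\{xQ_1+yQ_2+zQ_3=0\}\subset\mathbb{P}^2\times\mathbb{P}^5$ containing $X$. Let $q$ be the quadratic form in six variables over $\mathbb{Q}(\mathbb{P}^2)$ with Gram matrix $M(x,y,z)$ (dehomogenized); its discriminant extension is $\mathbb{Q}(S)=\mathbb{Q}(\mathbb{P}^2)(\sqrt{-\det M})$. The class $\alpha\in\mathrm{Br}(S)$ is the one whose image under $\mathrm{Br}(S)\hookrightarrow\mathrm{Br}(\mathbb{Q}(S))$ is the class of the even Clifford algebra $C_0(q)$, a central simple algebra over $\mathbb{Q}(S)$. Equivalently, $\alpha$ is the class of the Brauer--Severi variety $W\to S$ obtained by Stein factorization of the variety $W\to\mathbb{P}^2$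 parametrizing planes contained in the quadric fourfolds of the net. Here $\infty$ is the real place of $\mathbb{Q}$, $\alpha(P)\in\mathrm{Br}(\mathbb{R})$ is the pullback of $\alpha$ along $P\colon\mathrm{Spec}\,\mathbb{R}\to S$, and $\mathrm{inv}_\infty\colon\mathrm{Br}(\mathbb{R})\to\mathbb{Q}/\mathbb{Z}$ is the local invariant map (with image $\frac12\mathbb{Z}/\mathbb{Z}$). *)

(* Defs.v *)
From HB Require Import structures.
From mathcomp Require Import all_boot all_order all_algebra.
From mathcomp Require Import qpoly fraction complex mpoly boolp reals.

Set Implicit Arguments.
Unset Strict Implicit.
Unset Printing Implicit Defensive.

Import GRing.Theory Num.Theory.
Local Open Scope ring_scope.

(** * Free algebras of finite rank, Azumaya algebras, Brauer equivalence

    An algebra over [R] that is free with basis [(e_i)_(i : I)] is given by its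
    structure constants: [e_i * e_j = \sum_k T i j k *: e_k].  Over fields and
    local rings, the only bases needed below, every Azumaya algebra is free. *)

Definition algtab (R : Type) (I : Type) : Type := I -> I -> I -> R.

Section Algebras.
Variable R : comNzRingType.

Definition tmul (I : finType) (T : algtab R I) (x y : {ffun I -> R^o}) :
    {ffun I -> R^o} :=
  [ffun k => \sum_i \sum_j x i * y j * T i j k].

Definition alg_iso (I J : finType) (T : algtab R I) (T' : algtab R J) : Prop :=
  exists f : {linear {ffun I -> R^o} -> {ffun J -> R^o}},
    bijective f /\ forall x y, f (tmul T x y) = tmul T' (f x) (f y).

Definition tens (I J : Type) (T : algtab R I) (T' : algtab R J) :
    algtab R (I * J) :=
  fun p q r => T p.1 q.1 r.1 * T' p.2 q.2 r.2.

(** The matrix algebra, in the basis of elementary matrices [E_(a,b)]. *)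
Definition mat_alg (m : nat) : algtab R ('I_m * 'I_m) :=
  fun p q r => [&& p.2 == q.1, r.1 == p.1 & r.2 == q.2]%:R.
Arguments mat_alg : clear implicits.

Definition base_alg : algtab R unit := fun _ _ _ => 1.
Arguments base_alg : clear implicits.

Definition brauer_equiv (I J : finType) (T : algtab R I) (T' : algtab R J) :
    Prop :=
  exists m n : nat, alg_iso (tens T (mat_alg m.+1)) (tens T' (mat_alg n.+1)).

(** [T] is the table of an Azumaya algebra [A] over the subring [O] of [R]:
    [A] is a nonzero free [O]-module, associative and unital, and the map
    [A (x) A^op -> End_O(A)], [a (x) b |-> (x |-> a x b)], is bijective.  An
    endomorphism is given by its matrix [phi], [e_k |-> \sum_l phi (k, l) e_l],
    and the inner sum is the coefficient of [e_l] in [e_i e_k e_j]. *)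
Definition azumaya (O : R -> Prop) (I : finType) (T : algtab R I) : Prop :=
  [/\ (0 < #|I|)%N,
      forall i j k, O (T i j k),
      forall x y z, tmul T x (tmul T y z) = tmul T (tmul T x y) z,
      exists u : {ffun I -> R^o}, (forall i, O (u i)) /\
        forall x, tmul T u x = x /\ tmul T x u = x
    & forall phi : {ffun I * I -> R}, (forall p, O (phi p)) ->
        exists! c : {ffun I * I -> R}, (forall p, O (c p)) /\
          forall k l, \sum_i \sum_j c (i, j) * (\sum_m T i k m * T m j l)
                      = phi (k, l)].

End Algebras.

(** The local invariant [Br(R) -> Q/Z] at the real place, an element of [Q/Z]
    being written as its representative in [0, 1[: since [Br(R)] has order two,
    it is the map sending the trivial class to [0] and the other one to [1/2]. *)
Definition inv_infty (R : realType) (I : finType) (B : algtab R I) : rat :=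
  if `[< brauer_equiv B (base_alg R) >] then 0 else 2^-1.

(** * Clifford algebras *)

Definition quadf (R : comNzRingType) (n : nat) (A : 'M[R]_n) (v : 'rV[R]_n) : R :=
  (v *m A *m v^T) 0 0.

Definition is_clifford (K : fieldType) (n : nat) (A : 'M[K]_n) (C : algType K)
    (g : {linear 'rV[K]_n -> C}) : Prop :=
  (forall v, g v * g v = (quadf A v)%:A) /\
  forall (B : algType K) (f : {linear 'rV[K]_n -> B}),
    (forall v, f v * f v = (quadf A v)%:A) ->
    exists h : {lrmorphism C -> B},
      (forall v, h (g v) = f v) /\
      forall h' : {lrmorphism C -> B}, (forall v, h' (g v) = f v) -> h' =1 h.

Definition even_part (K : fieldType) (n : nat) (C : algType K)
    (g : {linear 'rV[K]_n -> C}) (x : C) : Prop :=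
  exists2 s : seq (K * seq 'rV[K]_n),
    all (fun t => ~~ odd (size t.2)) s &
    x = \sum_(t <- s) t.1 *: \prod_(v <- t.2) g v.

(** * The K3 surfaces attached to a net of quadrics

    A net is given by the Gram matrices [M 0], [M 1], [M 2] of
    [Q_1], [Q_2], [Q_3], i.e. [Q_(i+1) v = quadf (M i) v]. *)

Definition gram_at (S : comNzRingType) (f : rat -> S) (M : 'I_3 -> 'M[rat]_6)
    (x y z : S) : 'M[S]_6 :=
  x *: map_mx f (M 0) + y *: map_mx f (M 1) + z *: map_mx f (M 2%:R).

(** Smoothness of [X = V(Q_1, Q_2, Q_3)] as a complete intersection, by the
    Jacobian criterion at the complex points; up to the factor [2], the row
    vector [v *m M i] is the gradient of [Q_(i+1)] at [v].  A smooth complete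
    intersection of three quadrics in P^5 is a K3 surface of degree eight. *)
Definition smooth_X (R : realType) (M : 'I_3 -> 'M[rat]_6) : Prop :=
  forall v : 'rV[R[i]]_6, v != 0 ->
    (forall i, quadf (map_mx ratr (M i)) v = 0) ->
    row_free (\matrix_(i < 3) (v *m map_mx ratr (M i))).

(** [w ^ 2 + det M(x, y, z)], with [(x, y, z, w) = ('X_0, 'X_1, 'X_2, 'X_3)]. *)
Definition eqn_S (M : 'I_3 -> 'M[rat]_6) : {mpoly rat[4]} :=
  'X_(3%:R) ^+ 2 + \det (gram_at (@mpolyC 4 rat) M 'X_0 'X_1 'X_(2%:R)).

Definition evalp (A : comUnitRingType) (P : 'rV[A]_4) (p : {mpoly rat[4]}) : A :=
  mmap ratr (fun i => P 0 i) p.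

(** Smoothness of [S] in [P(1,1,1,3)], by the Jacobian criterion at the complex
    points; the singular point [(0 : 0 : 0 : 1)] of [P(1,1,1,3)] is not on [S]. *)
Definition smooth_S (R : realType) (M : 'I_3 -> 'M[rat]_6) : Prop :=
  forall P : 'rV[R[i]]_4, P != 0 -> evalp P (eqn_S M) = 0 ->
    exists i, evalp P (mderiv i (eqn_S M)) != 0.

(** Real points of [S], given by weighted homogeneous coordinates.  Every real
    point has real coordinates, unique up to
    [(x, y, z, w) ~ (c x, c y, c z, c ^ 3 w)] with [c] real and nonzero. *)
Definition real_point (R : realType) (M : 'I_3 -> 'M[rat]_6) (P : 'rV[R]_4) :
    Prop :=
  P != 0 /\ evalp P (eqn_S M) = 0.

(** * The function field of [S] and evaluation at a real point *)

Definition QP2 : fieldType := {fraction {mpoly rat[2]}}.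

Definition QP2_s : QP2 := tofrac ('X_0 : {mpoly rat[2]}).
Definition QP2_t : QP2 := tofrac ('X_1 : {mpoly rat[2]}).

(** Gram matrix of the generic quadric [q], in the chart
    [(x : y : z) = (s : t : 1)]. *)
Definition gram_gen (M : 'I_3 -> 'M[rat]_6) : 'M[QP2]_6 :=
  gram_at ratr M QP2_s QP2_t 1.

(** [Q(S) = QP2[w] / (w ^ 2 + det M(s, t, 1))].  Only the commutative ring
    structure is used; it is a field when [S] is smooth. *)
Definition funS (M : 'I_3 -> 'M[rat]_6) : comUnitAlgType QP2 :=
  {poly %/ 'X^2 + (\det (gram_gen M))%:P}.

Definition gen_point (M : 'I_3 -> 'M[rat]_6) : 'rV[funS M]_4 :=
  \row_(i < 4) nth 0 [:: QP2_s%:A; QP2_t%:A; 1; ('qX : funS M)] i.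

Definition whomog (d : nat) (p : {mpoly rat[4]}) : Prop :=
  forall m : 'X_{1..4}, m \in msupp p ->
    (\sum_(i < 4) nth 0 [:: 1; 1; 1; 3] i * m i)%N = d.

(** The rational function [f] on [S] is regular at [P], with value [v]: it is
    the quotient of two weighted homogeneous polynomials [a], [b] of the same
    degree, with [b] not vanishing at [P]. *)
Definition regular_val (R : realType) (M : 'I_3 -> 'M[rat]_6) (P : 'rV[R]_4)
    (f : funS M) (v : R) : Prop :=
  exists (d : nat) (a b : {mpoly rat[4]}),
    [/\ whomog d a, whomog d b, evalp P b != 0,
        f * evalp (gen_point M) b = evalp (gen_point M) a
      & v = evalp P a / evalp P b].

Definition local_ring (R : realType) (M : 'I_3 -> 'M[rat]_6) (P : 'rV[R]_4) :
    funS M -> Prop :=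
  fun f => exists v, regular_val P f v.

(** * The Brauer class and its values *)

(** [A] is the table, in some basis, of the even Clifford algebra [C_0(q)] seen
    as an algebra over [Q(S)], through an identification [zeta] over [QP2] of
    [Q(S)] with the centre of [C_0(q)].  There are two choices of [zeta],
    exchanged by the covering involution of [S]; both are allowed. *)
Definition even_clifford_tab (M : 'I_3 -> 'M[rat]_6) (I : finType)
    (A : algtab (funS M) I) : Prop :=
  exists (C : algType QP2) (g : {linear 'rV[QP2]_6 -> C})
         (zeta : {lrmorphism funS M -> C}) (b : I -> C),
    [/\ is_clifford (gram_gen M) g,
        forall l, even_part g (zeta l) /\
          forall x, even_part g x -> zeta l * x = x * zeta l,
        forall i, even_part g (b i),
        forall x, even_part g x ->
          exists! l : {ffun I -> funS M}, x = \sum_i zeta (l i) * b i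
      & forall i j, b i * b j = \sum_k zeta (A i j k) * b k].

(** The class of [A] in [Br(Q(S))] comes from [Br(O_(S,P))], and [B] represents
    its pullback along [P : Spec R -> S]: an Azumaya algebra over [O_(S,P)] with
    generic fibre Brauer equivalent to [A] has [B] as its fibre at [P].  Since
    [Br(O_(S,P))] injects into [Br(Q(S))], the class of [B] depends only on [P]
    and on the class of [A]. *)
Definition brauer_value (R : realType) (M : 'I_3 -> 'M[rat]_6) (P : 'rV[R]_4)
    (I J : finType) (A : algtab (funS M) I) (B : algtab R J) : Prop :=
  exists T : algtab (funS M) J,
    [/\ azumaya (@local_ring R M P) T,
        brauer_equiv T A
      & forall i j k, regular_val P (T i j k) (B i j k)].

(* Main.v *)
Require Import Defs.
From HB Require Import structures.
From mathcomp Require Import all_boot all_order all_algebra.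
From mathcomp Require Import qpoly fraction complex mpoly boolp reals.
From mathcomp Require Import polyrcf ring lra zify.
From mathcomp Require classical_sets.

(** Write [M(v)] for the real symmetric matrix of the net at [v], and [q] for
    the generic quadratic form over Q(P^2).

    A point of signature (3, 3).  Since [M(- v) = - M(v)], the conditions that
    [M(v)] has at least four positive squares, or at least four negative
    squares, are exchanged by [v |-> - v]; they are open and disjoint, so on a
    path from [- v] to [v] both fail somewhere.  Smoothness of [S] forces [M(v)]
    to have corank at most one at every real [v != 0]: at corank two the
    determinant vanishes to second order in every direction ([net_corank]).  So
    at the point found the form has signature (3, 3), or it has corank one and
    signature (3, 2) or (2, 3), and then moving off the discriminant curve
    towards [det M < 0] makes the signature (3, 3) ([split_sign_point]).

    A generic point.  Signature (3, 3) is an open condition, so it holds at a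
    point [(s : t : 1)] with [s], [t] algebraically independent over Q
    ([alg_indep_near]).  There every rational function on [S] is regular
    ([regular_all]): the local ring of [S] at [P] is the whole function field, no
    Azumaya model has to be constructed, and the value of [alpha] at [P] is its
    multiplication table evaluated at [P].

    The value is split.  A real form of signature (3, 3) is the Pfaffian on skew
    4 x 4 matrices ([pfaff_coords]), so that sending a skew matrix [A] with
    Pfaffian adjoint [A'] to the block matrix with off-diagonal blocks [A], [A']
    is a Clifford map into M_8(R).  The universal property extends it to the
    Clifford algebra of [q], and the image of the even part spans all
    block-diagonal matrices ([evspan_diag2]).  Central elements act by scalars on
    each of the two blocks; this gives two evaluations Q(S) -> R, at points with
    opposite coordinate [w] ([ev_conj]).  Choosing [P] to be the point seen by
    the first block, the basis of [alpha] is sent to a spanning family of M_4(R).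
    It has at most 16 elements, because 32 monomials span the even part over
    Q(P^2) ([card_even_basis]).  Hence the family is a basis of M_4(R), and
    [alpha(P)] is M_4(R) ([tab_split]).

    Finally [alpha] is Azumaya: the determinant that expresses this is nonzero at
    both points, because it is so for M_4(R), hence its norm to Q(P^2) is nonzero
    and it is invertible in Q(S) ([ev_unit], [tab_azumaya]). *)

Set Implicit Arguments.
Unset Strict Implicit.
Unset Printing Implicit Defensive.

Import Order.TTheory GRing.Theory Num.Theory.
Local Open Scope ring_scope.

(** * Diagonalization of real quadratic forms *)

Section Inertia.
Variable R : rcfType.

Lemma quadfE n (A : 'M[R]_n) v : quadf A v = \sum_i \sum_j v 0 i * v 0 j * A i j.
Proof.
rewrite /quadf mxE exchange_big /=; apply: eq_bigr => j _.
rewrite !mxE mulr_suml; apply: eq_bigr => i _.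
by rewrite mulrAC.
Qed.

Lemma quadf_mul k n (A : 'M[R]_n) (W : 'M_(k, n)) v :
  quadf A (v *m W) = quadf (W *m A *m W^T) v.
Proof. by rewrite /quadf trmx_mul !mulmxA. Qed.

Lemma quadf_diag n (d v : 'rV[R]_n) :
  quadf (diag_mx d) v = \sum_i d 0 i * v 0 i ^+ 2.
Proof.
rewrite quadfE; apply: eq_bigr => i _.
rewrite (bigD1 i) //= big1 ?addr0; last first.
  by move=> j ji; rewrite mxE eq_sym (negPf ji) mulr0.
by rewrite mxE eqxx mulr1n mulrC expr2.
Qed.

Lemma quadf_neq0 n (A : 'M[R]_n) :
  A^T = A -> A != 0 -> exists v, quadf A v != 0.
Proof.
move=> As An0; apply: contrapT => Hv; case/eqP: An0.
have q0 v : quadf A v = 0.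
  by apply/eqP; apply: contrapT => /negP h; apply: Hv; exists v.
apply/matrixP=> i j; rewrite [RHS]mxE.
pose e i : 'rV[R]_n := delta_mx 0 i.
have bil k l : (e k *m A *m (e l)^T) 0 0 = A k l.
  by rewrite -rowE trmx_delta -colE !mxE.
have := q0 (e i + e j); rewrite /quadf linearD /= !mulmxDl !mulmxDr.
rewrite [X in X = _]mxE [X in X + _ = _]mxE [X in _ + X = _]mxE.
have := q0 (e i); have := q0 (e j); rewrite /quadf !bil => -> ->.
have -> : A j i = A i j by rewrite -[A in LHS]As mxE.
move=> /eqP; rewrite add0r addr0 -mulr2n mulrn_eq0 /=.
by move/eqP.
Qed.

(** Gauss elimination by congruence.  A nonzero symmetric matrix has a vector [v]
    with [q v != 0] by polarization; with [v] as first basis vector the top left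
    entry is invertible, and the Schur complement splits off. *)
Lemma congr_diag n (A : 'M[R]_n) : A^T = A ->
  exists2 D, D \in unitmx & exists d, D *m A *m D^T = diag_mx d.
Proof.
elim: n A => [|n IHn] A As.
  by exists 1%:M; rewrite ?unitmx1 //; exists 0; rewrite [LHS]flatmx0 [RHS]flatmx0.
have [->|An0] := eqVneq A 0.
  by exists 1%:M; rewrite ?unitmx1 //; exists 0; rewrite mulmx0 mul0mx raddf0.
have [v qv] := quadf_neq0 As An0.
pose D0 : 'M_(1 + n) := row_ebase v.
have D0u : D0 \in unitmx by apply: row_ebase_unit.
have v0 : v != 0.
  by apply: contraNneq qv => ->; rewrite /quadf !mul0mx mxE.
pose e0 : 'rV[R]_n.+1 := delta_mx 0 0.
have Ev : v = col_ebase v 0 0 *: (e0 *m D0).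
  rewrite -[LHS](mulmx_ebase v).
  have rk : \rank v = 1%N.
    by apply/eqP; rewrite eqn_leq rank_leq_row lt0n mxrank_eq0.
  rewrite rk {1}[col_ebase v]mx11_scalar -mulmxA mul_scalar_mx; congr (_ *: (_ *m _)).
  by apply/matrixP=> i j; rewrite !mxE !ord1; case: j => [[|j] hj].
pose A1 : 'M[R]_(1 + n) := D0 *m (A : 'M_(1 + n)) *m D0^T.
have A1s : A1^T = A1 by rewrite /A1 !trmx_mul trmxK (As : (A : 'M_(1 + n))^T = A) mulmxA.
have a0 : ulsubmx A1 0 0 != 0.
  apply: contraNneq qv => h.
  rewrite Ev /quadf linearZ /= -!scalemxAl -scalemxAr.
  apply/eqP; rewrite [LHS]mxE [X in _ * X]mxE.
  have -> : (e0 *m D0 *m A *m (e0 *m D0)^T) 0 0 = ulsubmx A1 0 0 :> R.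
    rewrite trmx_mul !mulmxA -2!(mulmxA e0) -rowE trmx_delta -colE !mxE.
    by rewrite (_ : lshift n 0 = 0) //; apply: val_inj.
  by rewrite h !mulr0.
pose a := ulsubmx A1; pose r := ursubmx A1; pose B := drsubmx A1.
have EA1 : A1 = block_mx a r r^T B.
  by rewrite /r trmx_ursub A1s submxK.
have Bs : B^T = B by rewrite /B trmx_drsub A1s.
have au : a \in unitmx by rewrite unitmxE [a]mx11_scalar det_scalar1 unitfE.
have aT : a^T = a by rewrite [a]mx11_scalar tr_scalar_mx.
pose L : 'M_(1 + n) := block_mx 1%:M 0 (- (r^T *m invmx a)) 1%:M.
have Lu : L \in unitmx by rewrite unitmxE det_lblock !det1 mulr1 unitr1.
pose B' := B - r^T *m invmx a *m r.
have ivT : (invmx a)^T = invmx a by rewrite trmx_inv aT.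
have EL : L *m A1 *m L^T = block_mx a 0 0 B'.
  rewrite EA1 /L tr_block_mx !mulmx_block.
  rewrite !(trmx1, trmx0, mulmx1, mul1mx, mulmx0, mul0mx, addr0, add0r) linearN /=.
  rewrite !trmx_mul trmxK ivT !mulmxN !mulmxA !mulNmx mulmxV // mul1mx.
  rewrite -(mulmxA _ (invmx a) a) mulVmx // mulmx1 !addNr !mul0mx oppr0 add0r.
  by rewrite addrC.
have [|D2 D2u [d2 E2]] := IHn B'.
  by rewrite /B' linearB /= Bs !trmx_mul trmxK ivT mulmxA.
pose D3 : 'M_(1 + n) := block_mx 1%:M 0 0 D2.
have D3u : D3 \in unitmx by rewrite unitmxE det_lblock det1 mul1r.
exists (D3 *m L *m D0 : 'M_(1 + n)).
  by rewrite !unitmx_mul D0u Lu D3u.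
exists (row_mx a d2).
have -> : D3 *m L *m D0 *m (A : 'M_(1 + n)) *m (D3 *m L *m D0)^T
        = D3 *m (L *m A1 *m L^T) *m D3^T.
  by rewrite /A1 !trmx_mul !mulmxA.
rewrite EL /D3 tr_block_mx !mulmx_block.
rewrite !(trmx1, trmx0, mulmx1, mul1mx, mulmx0, mul0mx, addr0, add0r) E2.
apply: etrans (esym (diag_mx_row a d2)); congr block_mx.
by apply/matrixP=> i j; rewrite !ord1 !mxE eqxx mulr1n.
Qed.

(** At least [k] positive squares.  Phrased with a subspace rather than with
    eigenvalues, so that invariance and openness are immediate. *)
Definition pos_dim k n (A : 'M[R]_n) :=
  exists W : 'M[R]_(k, n), forall x : 'rV_k, x != 0 -> 0 < quadf A (x *m W).

(** A vector common to the two subspaces would have a value that is both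
    positive and nonpositive. *)
Lemma pos_semineg_dim a b n (A : 'M[R]_n) (W' : 'M_(b, n)) :
  pos_dim a A -> row_free W' -> (forall y, quadf A (y *m W') <= 0) ->
  (a + b <= n)%N.
Proof.
move=> [W Wpos] W'free W'neg; rewrite leqNgt; apply/negP => lt_n.
have : kermx (col_mx W W') != 0.
  rewrite kermx_eq0 -row_leq_rank -ltnNge.
  by apply: leq_ltn_trans lt_n; apply: rank_leq_col.
case/rowV0Pn => z /sub_kermxP; rewrite -[z]hsubmxK mul_row_col => zW.
have xyW : lsubmx z *m W = - (rsubmx z *m W').
  by apply/eqP; rewrite -addr_eq0 zW.
have [x0|xn0 _] := eqVneq (lsubmx z) 0; last first.
  have := Wpos _ xn0; rewrite xyW -mulNmx => /lt_le_trans/(_ (W'neg _)).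
  by rewrite ltxx.
have [-> |yn0 _] := eqVneq (rsubmx z) 0; first by rewrite x0 row_mx0 eqxx.
move: xyW; rewrite x0 mul0mx => /esym/eqP; rewrite oppr_eq0 => /eqP yW.
by case/eqP: yn0; apply: (row_free_inj W'free); rewrite mul0mx.
Qed.

Lemma pos_neg_dim a b n (A : 'M[R]_n) :
  pos_dim a A -> pos_dim b (- A) -> (a + b <= n)%N.
Proof.
move=> Apos [W Wneg].
have qN v : quadf (- A) v = - quadf A v by rewrite /quadf mulmxN mulNmx mxE.
apply: (pos_semineg_dim (W' := W)) Apos _ _.
  rewrite -kermx_eq0; apply: contraT => /rowV0Pn[z /sub_kermxP zW zn0].
  by have := Wneg _ zn0; rewrite zW /quadf !mul0mx mxE ltxx.
move=> y; have [->|yn0] := eqVneq y 0; first by rewrite /quadf !mul0mx mxE.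
by have := Wneg _ yn0; rewrite qN oppr_gt0 => /ltW.
Qed.

Lemma diag_sub k n (A D : 'M[R]_n) d (f : 'I_k -> 'I_n) (c : 'rV_k) :
  D *m A *m D^T = diag_mx d -> injective f ->
  (diag_mx c *m rowsub f D) *m A *m (diag_mx c *m rowsub f D)^T
  = diag_mx (\row_i (c 0 i ^+ 2 * d 0 (f i))).
Proof.
move=> ED injf.
have E : rowsub f D *m A *m (rowsub f D)^T = diag_mx (\row_i d 0 (f i)).
  have -> : rowsub f D = rowsub f 1%:M *m D by rewrite mul_rowsub_mx mul1mx.
  rewrite trmx_mul !mulmxA -2!(mulmxA (rowsub f 1%:M)) ED.
  apply/matrixP=> i j; rewrite mul_rowsub_mx mul1mx !mxE.
  rewrite (bigD1 (f j)) //= big1 => [|l /negPf lj]; rewrite !mxE; last first.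
    by rewrite (eq_sym (f j)) lj mulr0.
  by rewrite eqxx mulr1 addr0 (inj_eq injf).
rewrite trmx_mul tr_diag_mx !mulmxA -!(mulmxA (diag_mx c)) E !mulmxA.
rewrite !mulmx_diag; congr diag_mx; apply/rowP=> j; rewrite !mxE.
by ring.
Qed.

(** For [d] the diagonal of a diagonalization, the positive index of inertia. *)
Definition npos n (d : 'rV[R]_n) := #|[pred i | 0 < d 0 i]|.

(** The rows of [D] with [d 0 i <= 0] span a nonpositive subspace of
    complementary dimension, so this is half of the law of inertia;
    [pos_dim_card] is the other half. *)
Lemma card_pos_dim k n (A D : 'M[R]_n) d :
  D \in unitmx -> D *m A *m D^T = diag_mx d ->
  pos_dim k A -> (k <= npos d)%N.
Proof.
move=> Du ED Apos.
pose N := [pred i | ~~ (0 < d 0 i)].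
pose W' := rowsub (@enum_val _ N) D.
have inj_ev : injective (@enum_val _ N) by apply: enum_val_inj.
rewrite -(leq_add2r #|N|) /npos cardC card_ord.
apply: (pos_semineg_dim (W' := W')) Apos _ _ => [|y].
  rewrite /W' -[D]mul1mx -mul_rowsub_mx /row_free mxrankMfree ?row_free_unit //.
  rewrite -/(row_free _); apply/row_freeP; exists (rowsub (@enum_val _ N) 1%:M)^T.
  apply/matrixP=> i j; rewrite mul_rowsub_mx mul1mx !mxE.
  by rewrite eq_sym (inj_eq inj_ev).
rewrite quadf_mul.
have := diag_sub (const_mx 1) ED inj_ev.
rewrite diag_const_mx mul1mx -/W' => ->; rewrite quadf_diag sumr_le0 // => i _.
rewrite !mxE expr1n mul1r mulr_le0_ge0 ?sqr_ge0 //.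
by have := enum_valP i; rewrite inE -leNgt.
Qed.

(** Selecting and rescaling rows of a diagonalization gives any prescribed
    pattern of signs that occurs in it. *)
Lemma diag_normal k n (A D : 'M[R]_n) d (f : 'I_k -> 'I_n) (s : 'I_k -> bool) :
  D *m A *m D^T = diag_mx d -> injective f ->
  (forall i, 0 < (-1) ^+ s i * d 0 (f i)) ->
  exists W : 'M_(k, n), W *m A *m W^T = diag_mx (\row_i (-1) ^+ s i).
Proof.
move=> ED injf sP.
exists (diag_mx (\row_i (Num.sqrt ((-1) ^+ s i * d 0 (f i)))^-1) *m rowsub f D).
rewrite (diag_sub _ ED injf); congr diag_mx; apply/rowP=> j; rewrite !mxE.
rewrite exprVn sqr_sqrtr ?ltW // invfM -mulrA mulVf ?mulr1.
  by rewrite invr_sign.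
by have := lt0r_neq0 (sP j); rewrite mulf_eq0 negb_or => /andP[].
Qed.

Lemma pos_normal k n (A : 'M[R]_n) : A^T = A -> pos_dim k A ->
  exists W : 'M_(k, n), W *m A *m W^T = 1%:M.
Proof.
move=> As Apos; have [D Du [d ED]] := congr_diag As.
have lek := card_pos_dim Du ED Apos.
pose f (i : 'I_k) := enum_val (widen_ord lek i).
have injf : injective f by move=> i j /enum_val_inj/(congr1 val) /= /val_inj.
have fpos i : 0 < (-1) ^+ false * d 0 (f i).
  by rewrite expr0 mul1r; have := enum_valP (widen_ord lek i); rewrite inE.
have [W EW] := diag_normal ED injf fpos.
exists W; rewrite EW -diag_const_mx; congr diag_mx.
by apply/rowP=> j; rewrite !mxE expr0.
Qed.

(** Diagonal dominance, from [2 |x_i x_j| <= x_i ^ 2 + x_j ^ 2].  With the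
    bound [1 / (k + 1)] the form is at least the sum of squares divided by
    [k + 1]. *)
Lemma near_id_pos k (G : 'M[R]_k) (x : 'rV_k) :
  (forall i j, `|G i j - (i == j)%:R| < k.+1%:R^-1) -> x != 0 -> 0 < quadf G x.
Proof.
move=> Gid xn0; set e := k.+1%:R^-1 in Gid.
have e0 : 0 < e by rewrite invr_gt0 ltr0n.
pose S := \sum_i x 0 i ^+ 2.
have S0 : 0 < S.
  case/rV0Pn: xn0 => i xi; rewrite /S (bigD1 i) //= ltr_pwDl //.
    by rewrite exprn_even_gt0.
  by rewrite sumr_ge0 // => j _; rewrite sqr_ge0.
have -> : quadf G x = S + \sum_i \sum_j x 0 i * x 0 j * (G i j - (i == j)%:R).
  rewrite quadfE /S -big_split; apply: eq_bigr => i _ /=.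
  rewrite [in RHS](eq_bigr (fun j => x 0 i * x 0 j * G i j - x 0 i * x 0 j * (i == j)%:R)).
    have -> : x 0 i ^+ 2 = \sum_j x 0 i * x 0 j * (i == j)%:R.
      rewrite (bigD1 i) //= eqxx mulr1 -expr2 [X in _ + X]big1 ?addr0 // => j ji.
      by rewrite eq_sym (negPf ji) mulr0.
    by rewrite sumrB; ring.
  by move=> j _; rewrite mulrBr.
have bnd : \sum_i \sum_j x 0 i * x 0 j * (G i j - (i == j)%:R) >= - (e * k%:R * S).
  have -> : - (e * k%:R * S) = \sum_i \sum_j - (e * ((x 0 i ^+ 2 + x 0 j ^+ 2) / 2)).
    under eq_bigr do rewrite sumrN -mulr_sumr -mulr_suml big_split /= sumr_const card_ord.
    rewrite sumrN -mulr_sumr -mulr_suml big_split /= sumr_const card_ord sumrMnl -/S.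
    by rewrite -mulr_natr; field.
  apply: ler_sum => i _; apply: ler_sum => j _.
  rewrite lerNl (le_trans (ler_norm _)) // normrN normrM mulrC ler_pM //.
    exact: ltW.
  rewrite normrM -[x 0 i ^+ 2]real_normK ?num_real // -[x 0 j ^+ 2]real_normK ?num_real //.
  have := sqr_ge0 (`|x 0 i| - `|x 0 j|); lra.
apply: lt_le_trans (_ : S - e * k%:R * S <= _); last by rewrite lerD2l.
have -> : S - e * k%:R * S = e * S.
  rewrite /e; have : k.+1%:R != 0 :> R by rewrite pnatr_eq0.
  by rewrite -natr1 => h; field.
exact: mulr_gt0.
Qed.

End Inertia.

(** * Signature (3, 3) and its stability *)

Section Signature.
Variable R : rcfType.

Lemma quadf_id k (x : 'rV[R]_k) : x != 0 -> 0 < quadf 1%:M x.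
Proof.
move=> xn0; apply: near_id_pos xn0 => i j.
by rewrite mxE subrr normr0 invr_gt0 ltr0n.
Qed.

Lemma pos_dim_card k n (A D : 'M[R]_n) d :
  D *m A *m D^T = diag_mx d -> (k <= npos d)%N -> pos_dim k A.
Proof.
move=> ED lek; pose f (i : 'I_k) := enum_val (widen_ord lek i).
have injf : injective f by move=> i j /enum_val_inj/(congr1 val) /= /val_inj.
have fpos i : 0 < (-1) ^+ false * d 0 (f i).
  by rewrite expr0 mul1r; have := enum_valP (widen_ord lek i); rewrite inE.
have [W EW] := diag_normal ED injf fpos.
exists W => x xn0; rewrite quadf_mul EW.
suff -> : diag_mx (\row__ (-1) ^+ false) = 1%:M :> 'M[R]_k by apply: quadf_id.
by rewrite -diag_const_mx; congr diag_mx; apply/rowP=> j; rewrite !mxE expr0.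
Qed.

Definition nzero n (d : 'rV[R]_n) := #|[pred i | d 0 i == 0]|.

Lemma npos_split n (d : 'rV[R]_n) :
  (npos d + npos (- d) + nzero d = n)%N.
Proof.
rewrite /npos /nzero -[RHS]card_ord -(cardC [pred i | 0 < d 0 i]) -addnA; congr addn.
rewrite -(cardID [pred i | d 0 i == 0] [predC [pred i | 0 < d 0 i]]) addnC.
congr addn; apply: eq_card => i; rewrite !inE; first by case: ltrgt0P.
by rewrite mxE oppr_gt0; case: ltrgt0P.
Qed.

Lemma diagN n (A D : 'M[R]_n) d :
  D *m A *m D^T = diag_mx d -> D *m - A *m D^T = diag_mx (- d).
Proof. by move=> ED; rewrite mulmxN mulNmx ED linearN. Qed.

Lemma pos_neg4 (A : 'M[R]_6) : pos_dim 4 A -> ~ pos_dim 4 (- A).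
Proof. by move=> pA nA; have := pos_neg_dim pA nA. Qed.

Lemma npos_symm n (A D : 'M[R]_n) d a b : D \in unitmx ->
  D *m A *m D^T = diag_mx d -> pos_dim a A -> pos_dim b (- A) ->
  (a <= npos d)%N /\ (b <= npos (- d))%N.
Proof.
move=> Du ED pA nA; split; first exact: (card_pos_dim Du ED).
exact: (card_pos_dim Du (diagN ED)).
Qed.

(** Stated for all diagonalizations at once, so that zero diagonal entries need
    not be related to a rank. *)
Definition corank_le1 n (A : 'M[R]_n) := forall D d i j,
  D \in unitmx -> D *m A *m D^T = diag_mx d -> d 0 i = 0 -> d 0 j = 0 -> i = j.

Lemma sgr_prod_diag n (d : 'rV[R]_n) : (forall i, d 0 i != 0) ->
  Num.sg (\prod_i d 0 i) = (-1) ^+ npos (- d).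
Proof.
move=> dn0; rewrite (big_morph _ (@sgrM R) (@sgr1 R)).
rewrite (bigID [pred i | 0 < (- d) 0 i]) /= [X in _ * X]big1 ?mulr1; last first.
  move=> i; rewrite mxE oppr_gt0 -leNgt => di.
  by rewrite gtr0_sg // lt_neqAle eq_sym dn0.
rewrite /npos -prodr_const; apply: eq_bigr => i; rewrite mxE oppr_gt0 => di.
by rewrite ltr0_sg.
Qed.

Lemma det_congr_diag n (A D : 'M[R]_n) d : D *m A *m D^T = diag_mx d ->
  \prod_i d 0 i = \det A * \det D ^+ 2.
Proof. by move=> ED; rewrite -det_diag -ED !det_mulmx det_tr; ring. Qed.

(** The index and the coindex are at most three and add up to at least five.
    If they add up to six both equal three, and the determinant is negative. *)
Lemma pos_dim2 (A : 'M[R]_6) : A^T = A -> corank_le1 A ->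
  ~ pos_dim 4 A -> ~ pos_dim 4 (- A) ->
  [/\ pos_dim 2 A, pos_dim 2 (- A) & \det A <= 0].
Proof.
move=> As Ac npA nnA; have [D Du [d ED]] := congr_diag As.
have le1 : (nzero d <= 1)%N.
  apply/card_le1P => i /eqP di j; rewrite !inE.
  by apply/eqP/eqP => [dj|->//]; apply: Ac Du ED _ _.
have p3 : (npos d < 4)%N by rewrite ltnNge; apply/negP => /(pos_dim_card ED).
have n3 : (npos (- d) < 4)%N.
  by rewrite ltnNge; apply/negP => /(pos_dim_card (diagN ED)).
have Ed := npos_split d.
have [p2 n2] : (2 <= npos d)%N /\ (2 <= npos (- d))%N.
  by move: Ed le1 p3 n3; move: (npos d) (npos (- d)) (nzero d) => a b c; lia.
split; [exact: pos_dim_card ED p2 | exact: pos_dim_card (diagN ED) n2 |].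
rewrite leNgt; apply/negP => detA.
have : 0 < \prod_i d 0 i.
  rewrite (det_congr_diag ED) mulr_gt0 // exprn_even_gt0 //=.
  by move: Du; rewrite unitmxE unitfE.
move=> prod_gt0.
have dn0 i : d 0 i != 0.
  apply: contraTneq prod_gt0 => di; rewrite -leNgt (bigD1 i) //= di mul0r //.
have z0 : nzero d = 0%N.
  by apply: eq_card0 => i; rewrite !inE; apply/negbTE/dn0.
have := sgr_prod_diag dn0; rewrite gtr0_sg //.
have -> : npos (- d) = 3%N by move: Ed p3 n3; rewrite z0; move: (npos d) (npos (- d)) => a b; lia.
by move/eqP; rewrite -signr_odd /= expr1 -subr_eq0 opprK paddr_eq0 ?ler01 // oner_eq0.
Qed.

(** This is signature (3, 3) by [split_signP], expressed by conditions that are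
    visibly open.  The determinant excludes the even splittings (2, 4) and
    (4, 2) and the degenerate forms. *)
Definition split_sign (A : 'M[R]_6) :=
  [/\ A^T = A, pos_dim 2 A, pos_dim 2 (- A) & \det A < 0].

(** A negative determinant makes the number of negative squares odd, and two
    squares of each sign leave only three of each. *)
Lemma split_signP (A : 'M[R]_6) : split_sign A ->
  exists2 F, F \in unitmx &
    F *m A *m F^T = diag_mx (\row_(i < 6) (-1) ^+ (3 <= i)%N).
Proof.
case=> As pA nA detA; have [D Du [d ED]] := congr_diag As.
have [p2 n2] := npos_symm Du ED pA nA.
have prod_lt0 : \prod_i d 0 i < 0.
  rewrite (det_congr_diag ED) nmulr_rlt0 // exprn_even_gt0 //=.
  by move: Du; rewrite unitmxE unitfE.
have dn0 i : d 0 i != 0.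
  apply: contraTneq prod_lt0 => di; rewrite -leNgt (bigD1 i) //= di mul0r //.
have z0 : nzero d = 0%N.
  by apply: eq_card0 => i; rewrite !inE; apply/negbTE/dn0.
have oddn : odd (npos (- d)).
  have := sgr_prod_diag dn0; rewrite ltr0_sg // -signr_odd.
  case: odd => // /eqP; rewrite expr0 eq_sym -subr_eq0 opprK paddr_eq0 ?ler01 //.
  by rewrite oner_eq0.
have [p3 n3] : npos d = 3%N /\ npos (- d) = 3%N.
  move: (npos_split d) p2 n2 oddn; rewrite z0.
  by move: (npos d) (npos (- d)) => a b; lia.
pose sP := enum [pred i | 0 < d 0 i]; pose sN := enum [pred i | 0 < (- d) 0 i].
have sP3 : size sP = 3%N by rewrite -cardE.
have sN3 : size sN = 3%N by rewrite -cardE.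
pose f (i : 'I_6) := nth 0 (sP ++ sN) i.
have s6 : size (sP ++ sN) = 6%N by rewrite size_cat sP3 sN3.
have us : uniq (sP ++ sN).
  rewrite cat_uniq !enum_uniq andbT /=; apply/hasPn => i.
  by rewrite !mem_enum !inE mxE oppr_gt0 -leNgt => /ltW.
have injf : injective f.
  by move=> i j /eqP; rewrite nth_uniq ?s6 // => /eqP /val_inj.
have fs (i : 'I_6) : 0 < (-1) ^+ (3 <= i)%N * d 0 (f i).
  rewrite /f nth_cat sP3; case: (ltnP i 3) => i3 /=.
    have : nth 0 sP i \in sP by rewrite mem_nth // sP3.
    by rewrite mem_enum inE expr0 mul1r.
  have : nth 0 sN (i - 3) \in sN by rewrite mem_nth // sN3; case: i i3 => /= i; lia.
  by rewrite mem_enum inE mxE expr1 mulN1r.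
have [F EF] := diag_normal ED injf fs.
exists F => //; rewrite unitmxE unitfE.
have : \det (F *m A *m F^T) != 0.
  rewrite EF det_diag; apply/prodf_neq0 => i _.
  by rewrite mxE signr_eq0.
by rewrite !det_mulmx !mulf_eq0 !negb_or => /andP[/andP[]].
Qed.

(** A negative scalar exchanges the two halves of the signature, and the size
    six is even. *)
Lemma split_signZ (c : R) A : c != 0 -> split_sign A -> split_sign (c *: A).
Proof.
move=> cn0 [As pA nA detA].
have posZ a k n (B : 'M[R]_n) : 0 < a -> pos_dim k B -> pos_dim k (a *: B).
  move=> a0 [W HW]; exists W => x xn0.
  by rewrite /quadf -scalemxAr -scalemxAl mxE mulr_gt0 // HW.
split; rewrite ?linearZ /= ?As //.
- case/lt_total/orP: cn0 => c0; last exact: posZ.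
  by rewrite -[c]opprK scaleNr -scalerN; apply: posZ; rewrite ?oppr_gt0.
- case/lt_total/orP: cn0 => c0; last exact: posZ.
  by rewrite -[c]opprK scaleNr -scalerN opprK; apply: posZ; rewrite ?oppr_gt0.
by rewrite detZ pmulr_rlt0 // exprn_even_gt0 ?orbT.
Qed.

Definition near (t0 : R) (P : R -> Prop) :=
  exists2 e, 0 < e & forall t, `|t - t0| < e -> P t.

Lemma near_mono t0 (P Q : R -> Prop) :
  (forall t, P t -> Q t) -> near t0 P -> near t0 Q.
Proof. by move=> PQ [e e0 H]; exists e => // t /H /PQ. Qed.

Lemma near_and t0 (P Q : R -> Prop) :
  near t0 P -> near t0 Q -> near t0 (fun t => P t /\ Q t).
Proof.
move=> [e e0 HP] [e' e0' HQ]; exists (Num.min e e'); first by rewrite lt_min e0.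
by move=> t; rewrite lt_min => /andP[/HP ? /HQ].
Qed.

Lemma near_all t0 (I : finType) (P : I -> R -> Prop) :
  (forall i, near t0 (P i)) -> near t0 (fun t => forall i, P i t).
Proof.
move=> H.
suff: near t0 (fun t => forall i, i \in enum I -> P i t).
  by apply: near_mono => t Ht i; apply: Ht; rewrite mem_enum.
elim: (enum I) => [|i s IHs]; first by exists 1.
apply: near_mono (near_and (H i) IHs) => t [Pi Ps] j.
by rewrite inE => /predU1P[->|/Ps].
Qed.

Lemma near_horner (p : {poly R}) t0 e :
  0 < e -> near t0 (fun t => `|p.[t] - p.[t0]| < e).
Proof. by move=> /(poly_cont t0 p)[d d0 H]; exists d. Qed.

Lemma near_horner_lt0 (p : {poly R}) t0 : p.[t0] < 0 -> near t0 (fun t => p.[t] < 0).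
Proof.
move=> p0; have := near_horner p t0 (e := - p.[t0]); rewrite oppr_gt0 => /(_ p0).
apply: near_mono => t; rewrite ltr_norml => /andP[_]; lra.
Qed.

(** Whatever the sign of the derivative, the polynomial is negative on one side
    of a simple zero. *)
Lemma near_root_neg (p : {poly R}) (Q : R -> Prop) :
  p.[0] = 0 -> p^`().[0] != 0 -> near 0 Q -> exists t, Q t /\ p.[t] < 0.
Proof.
move=> /eqP /factor_theorem[q ->].
rewrite subr0 derivM derivX mulr1 hornerD hornerM hornerX mulr0 add0r => q0 nQ.
have nq := near_horner q 0 (e := `|q.[0]|); rewrite normr_gt0 in nq.
have [e e0 He] := near_and nQ (nq q0).
(* Near 0 the cofactor [q] keeps the sign of [q.[0]]; [t] takes the other. *)
pose t := - Num.sg q.[0] * (e / 2).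
have nt : `|t - 0| < e.
  rewrite subr0 normrM normrN normr_sg q0 mul1r gtr0_norm ?divr_gt0 //; lra.
have [Qt] := He t nt; exists t; split=> //.
rewrite hornerM hornerX.
have e20 : 0 < e / 2 by rewrite divr_gt0.
case: (ltrgt0P q.[0]) q0 b => // h _; rewrite ltr_norml => /andP[h1 h2].
- have t0 : t < 0 by rewrite /t gtr0_sg // mulN1r oppr_lt0.
  by rewrite nmulr_llt0 //; lra.
- have t0 : 0 < t by rewrite /t ltr0_sg // opprK mul1r.
  by rewrite pmulr_llt0 //; lra.
Qed.

Definition mx_at n (B : 'M[{poly R}]_n) t := map_mx (horner_eval t) B.

(** On a subspace where the form is normalized to the identity, it stays close
    to the identity, hence positive. *)
Lemma pos_dim_near k n (B : 'M[{poly R}]_n) t0 :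
  (mx_at B t0)^T = mx_at B t0 -> pos_dim k (mx_at B t0) ->
  near t0 (fun t => pos_dim k (mx_at B t)).
Proof.
move=> Bs /(pos_normal Bs)[W EW].
pose WP := map_mx polyC W.
have E t : W *m mx_at B t *m W^T = mx_at (WP *m B *m WP^T) t.
  have WE : map_mx (horner_eval t) WP = W.
    by rewrite -map_mx_comp map_mx_id // => x; rewrite /= /horner_eval hornerC.
  by rewrite /mx_at !map_mxM /= -map_trmx WE.
have : near t0 (fun t => forall i j,
    `|((WP *m B *m WP^T) i j).[t] - ((WP *m B *m WP^T) i j).[t0]| < k.+1%:R^-1).
  apply: near_all => i; apply: near_all => j; apply: near_horner.
  by rewrite invr_gt0 ltr0n.
apply: near_mono => t Ht; exists W => x xn0; rewrite quadf_mul.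
apply: near_id_pos xn0 => i j; have := Ht i j.
move/matrixP: (EW) => /(_ i j); rewrite !E [X in X = _ -> _]mxE [X in _ = X -> _]mxE.
by rewrite /horner_eval => -> ?; rewrite [mx_at _ _ _ _]mxE.
Qed.

Lemma split_sign_near (B : 'M[{poly R}]_6) t0 : B^T = B ->
  split_sign (mx_at B t0) -> near t0 (fun t => split_sign (mx_at B t)).
Proof.
move=> Bs [Bs0 pB nB dB].
have mN t : - mx_at B t = mx_at (- B) t.
  by apply/matrixP=> i j; rewrite !mxE /horner_eval hornerN.
have dE t : \det (mx_at B t) = (\det B).[t] by rewrite /mx_at det_map_mx.
have := near_and (pos_dim_near Bs0 pB) (near_and (pos_dim_near (k := 2) (B := - B) (t0 := t0) _ _)
  (near_horner_lt0 (p := \det B) (t0 := t0) _)).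
rewrite -!mN -dE linearN /= Bs0 => /(_ erefl nB dB).
apply: near_mono => t [pt [nt dt]]; split=> //; rewrite ?mN ?dE //.
by rewrite /mx_at map_trmx Bs.
Qed.

(** In a basis that diagonalizes [A], two rows of the pencil [A + X N] are
    divisible by [X], so its determinant is divisible by [X ^ 2]. *)
Lemma det_pencil_sqX n (A D N : 'M[R]_n) d i j : D \in unitmx ->
  D *m A *m D^T = diag_mx d -> i != j -> d 0 i = 0 -> d 0 j = 0 ->
  (\det (map_mx polyC A + 'X *: map_mx polyC N))^`().[0] = 0.
Proof.
move=> Du ED ij di dj; set B := _ + _.
pose DP := map_mx polyC D; pose N' := D *m N *m D^T.
pose e := \row_k (if (k == i) || (k == j) then 'X else 1 : {poly R}).
(* The pencil in the basis [D], with its two divisible rows divided by [X]. *)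
pose C : 'M[{poly R}]_n := \matrix_k (if (k == i) || (k == j) then row k (map_mx polyC N')
   else row k (map_mx polyC (diag_mx d) + 'X *: map_mx polyC N')).
have EB : DP *m B *m DP^T = diag_mx e *m C.
  have -> : DP *m B *m DP^T = map_mx polyC (diag_mx d) + 'X *: map_mx polyC N'.
    by rewrite mulmxDr mulmxDl -scalemxAr -scalemxAl -ED /N' !map_mxM /= map_trmx.
  apply/matrixP => k l; rewrite mul_diag_mx ![in RHS]mxE.
  case: ifP => [kij|_]; last by rewrite mul1r !mxE.
  rewrite !mxE.
  suff -> : d 0 k = 0 by rewrite mul0rn polyC0 add0r.
  by case/orP: kij => /eqP ->.
have dete : \det (diag_mx e) = 'X^2.
  rewrite det_diag (bigD1 i) //= (bigD1 j) 1?eq_sym //= big1 => [|k /andP[/negPf ki /negPf kj]].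
    by rewrite !mxE !eqxx orbT mulr1.
  by rewrite mxE ki kj.
have /(congr1 (fun p => p^`().[0])) : \det B * (\det D ^+ 2)%:P = 'X^2 * \det C.
  by rewrite -dete -det_mulmx -EB !det_mulmx det_tr det_map_mx rmorphXn; ring.
rewrite expr2 !derivM derivC derivX !(hornerD, hornerM, hornerC, hornerX).
rewrite !(mul0r, mulr0, addr0) => /eqP.
rewrite mulf_eq0 sqrf_eq0 => /orP[/eqP //|].
by move: Du; rewrite unitmxE unitfE => /negPf ->.
Qed.

End Signature.

(** Connectedness of a segment: at the supremum of the points of [P], either
    property would propagate to points of the other. *)
Lemma segment_connected (R : realType) (P Q : R -> Prop) a b : a <= b ->
  P a -> Q b -> (forall t, P t -> near t P) -> (forall t, Q t -> near t Q) ->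
  (forall t, a <= t <= b -> P t \/ Q t) -> exists t, P t /\ Q t.
Proof.
move=> ab Pa Qb Po Qo PQ.
pose S : classical_sets.set R := fun t => a <= t <= b /\ P t.
have Sa : S a by rewrite /S lexx ab.
have hS : classical_sets.has_sup S by split; [exists a | exists b => t [/andP[]]].
have ubS t : S t -> t <= sup S by move=> St; apply: sup_upper_bound.
have supb : sup S <= b by apply: ge_sup; [exists a | move=> t [/andP[]]].
have [Pc|Qc] := PQ (sup S) (introT andP (conj (ubS _ Sa) supb)).
  have [supE|supN] := eqVneq (sup S) b; first by exists b; split=> //; rewrite -supE.
  have ltb : sup S < b by rewrite lt_neqAle supN.
  have [e e0 He] := Po _ Pc.
  pose d := Num.min (e / 2) (b - sup S).
  have d0 : 0 < d by rewrite lt_min divr_gt0 //= subr_gt0.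
  have de : d < e by rewrite gt_min; apply/orP; left; lra.
  have db : d <= b - sup S by rewrite ge_min lexx orbT.
  suff /ubS : S (sup S + d) by lra.
  split; first by have := ubS _ Sa; lra.
  by apply: He; rewrite addrAC subrr add0r gtr0_norm.
have [e e0 He] := Qo _ Qc.
have [s [Ss Ps] ls] := sup_adherent e0 hS.
exists s; split=> //; apply: He; have := ubS _ (conj Ss Ps).
by rewrite ltr_norml => h; apply/andP; split; lra.
Qed.

(** * Real quadrics of the net *)

(** Polynomials are generated as a ring by constants and variables. *)
Lemma mpoly_alg_ind n (K : comNzRingType) (Q : {mpoly K[n]} -> Prop) :
  (forall c, Q c%:MP) -> (forall i, Q 'X_i) ->
  (forall p q, Q p -> Q q -> Q (p + q)) -> (forall p q, Q p -> Q q -> Q (p * q)) ->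
  forall p, Q p.
Proof.
move=> QC QX QD QM; apply: mpolyind; first by have := QC 0; rewrite mpolyC0.
move=> c m p _ _ Qp; apply: QD Qp; rewrite -mul_mpolyC; apply: (QM _ _ (QC c)).
rewrite mpolyXE_id; apply: (big_ind Q) => [||i _]; [ | exact: QM | ].
  by have := QC 1; rewrite mpolyC1.
by elim: (m i) => [|k IHk]; [have := QC 1; rewrite mpolyC1 expr0 | rewrite exprS; exact: QM].
Qed.

Lemma mmap_var n (K : nzRingType) (A : comNzRingType) (f : {rmorphism K -> A}) h i :
  mmap f h ('X_i : {mpoly K[n]}) = h i.
Proof. by rewrite mmapX mmap1U. Qed.

Lemma eq_mmap n (K : nzRingType) (A : nzRingType) (f f' : K -> A) (h h' : 'I_n -> A) :
  f =1 f' -> h =1 h' -> mmap f h =1 mmap f' h'.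
Proof.
move=> ff hh p; rewrite /mmap; apply: eq_bigr => m _; rewrite ff; congr (_ * _).
by apply: eq_bigr => i _; rewrite hh.
Qed.

Lemma mmap_comp n (K : nzRingType) (A B : comNzRingType) (f : {rmorphism K -> A})
    (g : {rmorphism A -> B}) h (p : {mpoly K[n]}) :
  g (mmap f h p) = mmap (g \o f) (g \o h) p.
Proof.
rewrite /mmap rmorph_sum; apply: eq_bigr => m _; rewrite rmorphM; congr (_ * _).
by rewrite rmorph_prod; apply: eq_bigr => i _; rewrite rmorphXn.
Qed.

Definition line_at (A : comNzRingType) n (h : 'I_n -> A) (i j : 'I_n) : {poly A} :=
  (h j)%:P + (i == j)%:R *: 'X.

(** The chain rule along a coordinate line.  It turns the partial derivatives in
    the smoothness condition into derivatives of polynomials in one variable. *)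
Lemma mmap_mderiv n (K A : comNzRingType) (f : {rmorphism K -> A}) h i (p : {mpoly K[n]}) :
  mmap f h (mderiv i p) = (mmap (polyC \o f) (line_at h i) p)^`().[0].
Proof.
pose F := mmap (polyC \o f) (line_at h i).
have F0 q : (F q).[0] = mmap f h q.
  rewrite -/(horner_eval 0 (F q)) mmap_comp; apply: eq_mmap => [c|j] /=.
    by rewrite /horner_eval hornerC.
  by rewrite /horner_eval /line_at hornerD hornerC hornerZ hornerX mulr0 addr0.
elim/mpoly_alg_ind: p => [c|j|p q IHp IHq|p q IHp IHq].
- by rewrite mderivC rmorph0 mmapC derivC horner0.
- rewrite mmap_var mderivX /line_at derivD derivC add0r derivZ derivX hornerZ hornerC mulr1.
  rewrite mnm1E (eq_sym i); case: eqP => [->|_]; last by rewrite scale0r rmorph0.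
  rewrite scale1r (_ : (U_(i) - U_(i))%MM = 0%MM) ?mmapX ?mmap11 //.
  by apply/mnmP => k; rewrite mnmBE mnm0E subnn.
- by rewrite mderivD !rmorphD /= derivD hornerD IHp IHq.
rewrite mderivM rmorphD !rmorphM /= derivM hornerD !hornerM IHp IHq.
by rewrite -/(F p) -/(F q) !F0.
Qed.

Section Net.
Variable M : 'I_3 -> 'M[rat]_6.

Lemma map_gram (A B : comNzRingType) (f : rat -> A) (g : {rmorphism A -> B}) x y z :
  map_mx g (gram_at f M x y z) = gram_at (g \o f) M (g x) (g y) (g z).
Proof. by apply/matrixP=> i j; rewrite !mxE !rmorphD !rmorphM. Qed.

Lemma eq_gram (A : comNzRingType) (f f' : rat -> A) x y z :
  f =1 f' -> gram_at f M x y z = gram_at f' M x y z.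
Proof. by move=> ff; apply/matrixP=> i j; rewrite !mxE !ff. Qed.

Lemma mmap_eqn (A : comNzRingType) (f : {rmorphism rat -> A}) h :
  mmap f h (eqn_S M) = h 3%:R ^+ 2 + \det (gram_at f M (h 0) (h 1) (h 2%:R)).
Proof.
rewrite /eqn_S rmorphD rmorphXn; congr (_ ^+ _ + _); first exact: mmap_var.
rewrite -det_map_mx map_gram /= !mmap_var; congr (\det _).
by apply: eq_gram => c /=; rewrite mmapC.
Qed.

Hypothesis M_sym : forall i, (M i)^T = M i.

Lemma gram_sym (A : comNzRingType) (f : rat -> A) x y z :
  (gram_at f M x y z)^T = gram_at f M x y z.
Proof. have E k i j : M k i j = M k j i by rewrite -[in LHS](M_sym k) mxE.
by apply/matrixP=> i j; rewrite !mxE (E 0) (E 1) (E 2%:R). Qed.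

Section RealNet.
Variables (R : realType) (S_smooth : smooth_S R M).

Definition netR (x y z : R) : 'M[R]_6 := gram_at ratr M x y z.
(** The matrix of the net along a polynomial path; [mx_at] specializes the
    parameter. *)
Definition netP (x y z : {poly R}) : 'M[{poly R}]_6 :=
  gram_at (polyC \o ratr) M x y z.

Lemma netR_sym x y z : (netR x y z)^T = netR x y z.
Proof. exact: gram_sym. Qed.

Lemma netP_sym x y z : (netP x y z)^T = netP x y z.
Proof. exact: gram_sym. Qed.

Lemma netP_at x y z t : mx_at (netP x y z) t = netR x.[t] y.[t] z.[t].
Proof.
rewrite /mx_at map_gram; apply: eq_gram => c /=.
by rewrite /horner_eval hornerC.
Qed.

Lemma netRZ c x y z : netR (c * x) (c * y) (c * z) = c *: netR x y z.
Proof. by rewrite /netR /gram_at !scalerDr !scalerA. Qed.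

Lemma netRN x y z : netR (- x) (- y) (- z) = - netR x y z.
Proof. by rewrite -scaleN1r -netRZ !mulN1r. Qed.

Definition dirP (k : 'I_3) (x y z : R) : 'M[{poly R}]_6 :=
  netP (x%:P + (k == 0)%:R *: 'X) (y%:P + (k == 1)%:R *: 'X)
       (z%:P + (k == 2%:R)%:R *: 'X).

Lemma dirPE k x y z :
  dirP k x y z = map_mx polyC (netR x y z) + 'X *: map_mx (polyC \o ratr) (M k).
Proof.
have [-> | ->| ->] : [\/ k = 0, k = 1 | k = 2%:R].
- case: k => [[|[|[|//]]] k3]; [constructor 1|constructor 2|constructor 3]; exact: val_inj.
- apply/matrixP=> i j; rewrite !mxE -!val_eqE /= !rmorphD !rmorphM /= scale1r !scale0r.
  by ring.
- apply/matrixP=> i j; rewrite !mxE -!val_eqE /= !rmorphD !rmorphM /= scale1r !scale0r.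
  by ring.
- apply/matrixP=> i j; rewrite !mxE -!val_eqE /= !rmorphD !rmorphM /= scale1r !scale0r.
  by ring.
Qed.

(** The partial derivative in [w] vanishes at [w = 0], so at a ramification
    point smoothness of [S] concerns [det M] only. *)
Lemma smooth_dir x y z : [|| x != 0, y != 0 | z != 0] -> \det (netR x y z) = 0 ->
  exists k, (\det (dirP k x y z))^`().[0] != 0.
Proof.
move=> xyz0 det0.
pose h (i : 'I_4) : R := nth 0 [:: x; y; z; 0] i.
pose f : {rmorphism rat -> R} := ratr.
pose g : {rmorphism R -> R[i]} := real_complex R.
have ratE : g \o f =1 ratr by apply: fmorph_eq_rat.
pose P : 'rV[R[i]]_4 := \row_i g (h i).
have evE p : evalp P p = g (mmap f h p).
  rewrite mmap_comp; apply: eq_mmap => [c|i]; first by rewrite ratE.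
  by rewrite /P mxE.
have Pn0 : P != 0.
  apply: contraTneq xyz0 => /rowP P0; rewrite !negb_or !negbK.
  have h0 i : h i = 0.
    by apply: (fmorph_inj g); have := P0 i; rewrite !mxE rmorph0.
  have := h0 0; have := h0 1; have := h0 2%:R; rewrite /h /= => -> -> ->.
  by rewrite eqxx.
have [|i] := S_smooth Pn0.
  by rewrite evE mmap_eqn /h /= expr0n add0r -/(netR x y z) det0 rmorph0.
rewrite evE fmorph_eq0 mmap_mderiv mmap_eqn.
set h' := line_at h i => hi.
have E : (h' 3%:R ^+ 2)^`().[0] = 0.
  by rewrite /h' /line_at /h /= add0r exprZn derivZ derivXn hornerZ hornerMn hornerXn mul0rn mulr0.
move: hi; rewrite derivD hornerD E add0r => hi.
have [i0|i1|i2|i3] : [\/ i = 0, i = 1, i = 2%:R | i = 3%:R].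
- case: i @h' hi E => [[|[|[|[|//]]]] i4] h' hi E;
    [constructor 1|constructor 2|constructor 3|constructor 4]; exact: val_inj.
- by exists 0; move: hi; rewrite /h' /line_at i0 /h /=.
- by exists 1; move: hi; rewrite /h' /line_at i1 /h /=.
- by exists 2%:R; move: hi; rewrite /h' /line_at i2 /h /=.
move: hi; rewrite /h' /line_at i3 -!val_eqE /= !scale0r !addr0.
suff -> : gram_at (polyC \o f) M (h 0)%:P (h 1)%:P (h 2%:R)%:P = map_mx polyC (netR x y z).
  by rewrite det_map_mx derivC horner0 eqxx.
by rewrite map_gram.
Qed.

(** At corank two the determinant vanishes to second order in every direction,
    and [S] would be singular. *)
Lemma net_corank x y z : [|| x != 0, y != 0 | z != 0] -> corank_le1 (netR x y z).
Proof.
move=> xyz0 D d i j Du ED di dj; apply/eqP; apply: contraT => ij.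
have det0 : \det (netR x y z) = 0.
  have := det_congr_diag ED; rewrite (bigD1 i) //= di mul0r => /esym/eqP.
  rewrite mulf_eq0 sqrf_eq0 => /orP[/eqP //|].
  by move: Du; rewrite unitmxE unitfE => /negPf ->.
have [k] := smooth_dir xyz0 det0.
by rewrite dirPE map_mx_comp (det_pencil_sqX _ Du ED ij di dj) eqxx.
Qed.

(** Along a path from [- M 0] to [M 0] the conditions of having four positive
    squares and of having four negative squares are open and disjoint, and they
    are exchanged between the ends.  So both fail somewhere, and there
    [pos_dim2] applies; if the determinant vanishes, moving in a direction in
    which it has a nonzero derivative makes it negative. *)
Lemma split_sign_point : exists x y z, split_sign (netR x y z).
Proof.
(* The parabola joins opposite ends and avoids the origin. *)
pose B := netP 'X (1 - 'X^2) 0.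
pose v t : R := 1 - t ^+ 2.
have BE t : mx_at B t = netR t (v t) 0.
  by rewrite /B netP_at !hornerE.
have v0 t : [|| t != 0, v t != 0 | 0 != 0 :> R].
  by rewrite /v; have [->|] := eqVneq t 0; rewrite // expr0n subr0 oner_eq0.
have [t [npt nnt]] : exists t, ~ pos_dim 4 (mx_at B t) /\ ~ pos_dim 4 (- mx_at B t).
  apply: contrapT => H.
  pose P t := pos_dim 4 (mx_at B t); pose Q t := pos_dim 4 (- mx_at B t).
  have PQ t : P t \/ Q t.
    have [?|nP] := pselect (P t); first by left.
    by right; apply: contrapT => nQ; apply: H; exists t.
  have NB t : mx_at (- B) t = - mx_at B t.
    by apply/matrixP=> i j; rewrite !mxE /horner_eval hornerN.
  have Po t : P t -> near t P.
    by apply: pos_dim_near; rewrite BE netR_sym.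
  have Qo t : Q t -> near t Q.
    rewrite /Q -NB => Qt.
    have Bs : (mx_at (- B) t)^T = mx_at (- B) t by rewrite NB BE linearN /= netR_sym.
    by apply: near_mono (pos_dim_near Bs Qt) => u; rewrite NB.
  have disj t : P t -> Q t -> False by apply: pos_neg4.
  have end_opp : mx_at B (-1) = - mx_at B 1.
    by rewrite !BE /v sqrrN expr1n subrr -netRN oppr0.
  have le11 : -1 <= 1 :> R by lra.
  have [P1|Q1] := PQ 1.
    have Qm : Q (-1) by rewrite /Q end_opp opprK.
    have [|s [Qs Ps]] := segment_connected le11 Qm P1 Qo Po; last exact: (disj s).
    by move=> s _; case: (PQ s); [right | left].
  have Pm : P (-1) by rewrite /P end_opp.
  have [s _|s [Ps Qs]] := segment_connected le11 Pm Q1 Po Qo; last exact: (disj s).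
  exact: PQ.
have At : (mx_at B t)^T = mx_at B t by rewrite BE netR_sym.
have corank : corank_le1 (mx_at B t) by rewrite BE; apply: net_corank.
have [p2 n2] := pos_dim2 At corank npt nnt.
rewrite le_eqVlt => /orP[/eqP det0|detneg]; last first.
  by exists t, (v t), 0; rewrite -BE.
rewrite BE in p2 n2 det0.
have [k dk] := smooth_dir (v0 t) det0.
set C := dirP k t (v t) 0 in dk.
have CE s : mx_at C s = netR (t + (k == 0)%:R * s) (v t + (k == 1)%:R * s)
    (0 + (k == 2%:R)%:R * s).
  by rewrite netP_at !(hornerD, hornerC, hornerZ, hornerX).
have C0 : mx_at C 0 = netR t (v t) 0 by rewrite CE !mulr0 !addr0.
have NC s : mx_at (- C) s = - mx_at C s.
  by apply/matrixP=> i j; rewrite !mxE /horner_eval hornerN.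
have nearP : near 0 (fun s => pos_dim 2 (mx_at C s)).
  by apply: pos_dim_near; rewrite C0 // netR_sym.
have nearN : near 0 (fun s => pos_dim 2 (mx_at (- C) s)).
  by apply: pos_dim_near; rewrite NC C0 // linearN /= netR_sym.
have detC s : \det (mx_at C s) = (\det C).[s] by rewrite /mx_at det_map_mx.
have Croot : (\det C).[0] = 0 by rewrite -detC C0.
have [s [[ps ns] ds]] := near_root_neg Croot dk (near_and nearP nearN).
rewrite NC in ns; rewrite -detC in ds.
move: ps ns ds; rewrite CE => ps ns ds.
by do 3!eexists; split; [exact: netR_sym | exact: ps | exact: ns | exact: ds].
Qed.

(** The last coordinate can be moved away from 0, and rescaling preserves
    signature (3, 3) even for a negative factor. *)
Lemma split_sign_affine : exists x y, split_sign (netR x y 1).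
Proof.
have [x [y [z xyz]]] := split_sign_point.
suff [z' z'n0 H] : exists2 z', z' != 0 & split_sign (netR x y z').
  exists (z'^-1 * x), (z'^-1 * y).
  by rewrite -(mulVf z'n0) netRZ; apply: split_signZ; rewrite ?invr_eq0.
have [z0|zn0] := eqVneq z 0; last by exists z.
pose B := netP x%:P y%:P 'X.
have BE t : mx_at B t = netR x y t by rewrite netP_at !hornerE.
have [e e0 He] : near 0 (fun t => split_sign (mx_at B t)).
  by apply: split_sign_near; rewrite ?BE ?netP_sym // -z0.
exists (e / 2); first by rewrite mulf_neq0 ?invr_eq0 ?pnatr_eq0 // gt_eqF.
by rewrite -BE; apply: He; rewrite subr0 gtr0_norm; lra.
Qed.

End RealNet.
End Net.

(** * Algebraically independent real numbers *)

Section Generic.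
Variable R : realType.

(** A polynomial vanishing on the whole interval would have too many roots, and
    by continuity it has no root near a point where it does not vanish. *)
Lemma nonroot_subitv (p : {poly R}) a b : p != 0 -> a < b ->
  exists2 ab : R * R, [/\ a < ab.1, ab.1 < ab.2 & ab.2 < b] &
    forall x, ab.1 <= x <= ab.2 -> p.[x] != 0.
Proof.
move=> pn0 ltab.
have [c [ac cb] pc] : exists2 c, a < c /\ c < b & p.[c] != 0.
  apply: contrapT => H.
  pose k := size p; pose f i : R := a + (b - a) * (i.+1%:R / k.+1%:R).
  have ba : 0 < b - a by rewrite subr_gt0.
  have k0 : 0 < k.+1%:R :> R by rewrite ltr0n.
  have finj : injective f.
    move=> i j /addrI /(mulfI (lt0r_neq0 ba)) /(mulIf _) H'.
    by apply/succn_inj/eqP; rewrite -(eqr_nat R); apply/eqP/H'; rewrite invr_eq0 lt0r_neq0.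
  have := @max_poly_roots _ p (map f (iota 0 k)) pn0.
  rewrite map_inj_uniq // iota_uniq size_map size_iota ltnn => /(_ _ isT) C.
  suff: false by []; apply: C.
  rewrite all_map; apply/allP => i; rewrite mem_iota add0n => /andP[_ ik] /=.
  rewrite /root; apply: contraT => fi; case: H; exists (f i) => //.
  have i0 : 0 < i.+1%:R / k.+1%:R :> R by rewrite divr_gt0 // ltr0n.
  have i1 : i.+1%:R / k.+1%:R < 1 :> R by rewrite ltr_pdivrMr // mul1r ltr_nat ltnS.
  rewrite /f; move: (_ / _) i0 i1 => u u0 u1.
  have h1 := mulr_gt0 ba u0; have h2 : (b - a) * u < b - a by rewrite gtr_pMr.
  by split; lra.
have [d d0 Hd] := near_horner p c (e := `|p.[c]|) (ltac:(by rewrite normr_gt0)).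
pose m := Num.min d (Num.min (c - a) (b - c)) / 2.
have m0 : 0 < m by rewrite divr_gt0 // !lt_min d0 !subr_gt0 ac cb.
have md : m < d by rewrite ltr_pdivrMr // gt_min; apply/orP; left; lra.
have mca : m < c - a.
  by rewrite ltr_pdivrMr // !gt_min; apply/orP; right; apply/orP; left; lra.
have mcb : m < b - c.
  by rewrite ltr_pdivrMr // !gt_min; apply/orP; right; apply/orP; right; lra.
exists (c - m, c + m) => /=; first by split; lra.
move=> x xcm; have : `|x - c| < d by rewrite ltr_norml; apply/andP; split; lra.
by move/Hd; apply: contraTneq => ->; rewrite sub0r normrN ltxx.
Qed.

(** Nested intervals, the n-th step avoiding the roots of [p n].  The supremum of
    the left ends lies in all of them. *)
Lemma avoid_roots_seq (p : nat -> {poly R}) x0 e : 0 < e -> (forall n, p n != 0) ->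
  exists2 x, `|x - x0| < e & forall n, (p n).[x] != 0.
Proof.
move=> e0 pn0.
pose next (s : nat * (R * R)) (ab : R * R) : Prop := s.2.1 < s.2.2 ->
  [/\ s.2.1 < ab.1, ab.1 < ab.2 & ab.2 < s.2.2] /\
  forall x, ab.1 <= x <= ab.2 -> (p s.1).[x] != 0.
have /choice[f Hf] s : exists ab, next s ab.
  case: s => n [a b]; rewrite /next /=.
  have [ltab|] := boolP (a < b); last by exists (a, b).
  by have [ab H1 H2] := nonroot_subitv (pn0 n) ltab; exists ab.
pose u := fix u n := if n is m.+1 then f (m, u m) else (x0 - e, x0 + e).
have ult n : (u n).1 < (u n).2.
  by elim: n => [|n IHn] /=; [lra | have [[]] := Hf (n, u n) IHn].
have uS n : [/\ (u n).1 < (u n.+1).1, (u n.+1).2 < (u n).2 &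
    forall x, (u n.+1).1 <= x <= (u n.+1).2 -> (p n).[x] != 0].
  by have [[? ? ?] ?] := Hf (n, u n) (ult n).
have mono n m : (n <= m)%N -> (u n).1 <= (u m).1 /\ (u m).2 <= (u n).2.
  elim: m => [|m IHm]; first by rewrite leqn0 => /eqP ->.
  rewrite leq_eqVlt => /orP[/eqP -> //|/IHm[l1 l2]].
  have [h1 h2 _] := uS m; split; first exact: ltW (le_lt_trans l1 h1).
  exact: ltW (lt_le_trans h2 l2).
have cross n m : (u n).1 <= (u m).2.
  have [h1 _] := mono _ _ (leq_maxl n m); have [_ h2] := mono _ _ (leq_maxr n m).
  exact: le_trans h1 (le_trans (ltW (ult _)) h2).
pose S : classical_sets.set R := fun t => exists n, t = (u n).1.
have Sn0 : exists t, S t by exists (u 0).1; exists 0%N.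
have hS : classical_sets.has_sup S.
  by split => //; exists (u 0).2 => t [n ->].
pose x := sup S.
have xl n : (u n).1 <= x by apply: sup_upper_bound => //; exists n.
have xr n : x <= (u n).2 by apply: ge_sup => // t [m ->].
exists x; last by move=> n; have [_ _] := uS n; apply; rewrite xl xr.
have [h1 h2 _] := uS 0%N; have := xl 1%N; have := xr 1%N.
by move: h1 h2 => /= h1 h2 h3 h4; rewrite ltr_norml; apply/andP; split; lra.
Qed.

Lemma avoid_roots (T : countType) (F : T -> {poly R}) x0 (Q : R -> Prop) :
  near x0 Q -> (forall t, F t != 0) -> exists2 x, Q x & forall t, (F t).[x] != 0.
Proof.
move=> [e e0 He] Fn0.
pose p n := if @unpickle T n is Some t then F t else 1.
have pn0 n : p n != 0 by rewrite /p; case: unpickle => // ; exact: oner_neq0.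
have [x xe Hx] := avoid_roots_seq x0 e0 pn0.
exists x; first exact: He.
by move=> t; have := Hx (pickle t); rewrite /p pickleK.
Qed.

(** Countably many polynomials have to be avoided. *)
Lemma avoid_transcendental (T : countNzRingType) (g : {rmorphism T -> R}) x0 (Q : R -> Prop) :
  injective g -> near x0 Q ->
  exists2 x, Q x & forall q : {poly T}, q != 0 -> (map_poly g q).[x] != 0.
Proof.
move=> ginj nQ.
pose F (q : {poly T}) : {poly R} := if q == 0 then 1 else map_poly g q.
have Fn0 q : F q != 0.
  rewrite /F; case: (eqVneq q 0) => [_|qn0]; first by rewrite oner_neq0.
  by rewrite -(rmorph0 (map_poly g)) (inj_eq (map_inj_poly ginj (rmorph0 g))).
have [x Qx Hx] := avoid_roots nQ Fn0; exists x => // q qn0.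
by have := Hx q; rewrite /F (negPf qn0).
Qed.

Definition pair_pt (A : Type) (s t : A) (i : 'I_2) : A := if i == 0 then s else t.

Definition alg_indep (s t : R) := forall p : {mpoly rat[2]},
  p != 0 -> mmap (ratr : rat -> R) (pair_pt s t) p != 0.

(** First [s] is taken transcendental over Q, then [t] transcendental over Q[s].
    A polynomial in two variables becomes a polynomial in [t] over Q[s]. *)
Lemma alg_indep_near (x y : R) (Q : R -> R -> Prop) :
  near x (fun s => Q s y) -> (forall s, Q s y -> near y (Q s)) ->
  exists s t, Q s t /\ alg_indep s t.
Proof.
move=> nx ny.
pose r : {rmorphism rat -> R} := ratr.
have [s Qs Hs] := avoid_transcendental (fmorph_inj r) nx.
pose th : {rmorphism {poly rat} -> R} := horner_eval s \o map_poly r.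
have th_inj : injective th.
  apply: raddf_inj => q /eqP; apply: contraTeq => qn0; exact: Hs.
have [t Qt Ht] := avoid_transcendental th_inj (ny _ Qs).
exists s, t; split=> // p pn0.
pose c2 : {rmorphism rat -> {poly {poly rat}}} := polyC \o polyC.
(* [p] as a polynomial in its second variable. *)
pose q : {poly {poly rat}} := mmap c2 (pair_pt 'X%:P 'X) p.
have qn0 : q != 0.
  apply: contraNneq pn0 => q0; apply/eqP/mpolyP => m; rewrite mcoeff0.
  have <- : q`_(m 1)`_(m 0) = p@_m; last by rewrite q0 !coef0.
  rewrite [in RHS](mpolyE p) raddf_sum /= /q /mmap !coef_sum.
  apply: eq_bigr => l _; rewrite mcoeffZ mcoeffX /mmap1 !big_ord_recl big_ord0 mulr1.
  rewrite (_ : lift ord0 ord0 = 1); last exact: val_inj.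
  rewrite /pair_pt /= -rmorphXn /= mulrA -rmorphM coefCM coefXn.
  rewrite -polyC_natr coefMC coefCM coefXn -mulrA -natrM mulnb.
  congr (_ * _%:R); congr nat_of_bool.
  apply/idP/eqP => [/andP[/eqP e1 /eqP e2]|->]; last by rewrite !eqxx.

  apply/mnmP => i; have [->|->] : i = 0 \/ i = 1; last by rewrite e2.
    by case: i => [[|[|//]]] i2; [left|right]; apply: val_inj.
  by rewrite [m 0]e1.
have := Ht q qn0; congr (_ != 0).
pose ht : {rmorphism {poly {poly rat}} -> R} := horner_eval t \o map_poly th.
rewrite -[LHS]/(ht q) mmap_comp; apply: eq_mmap => [|i].
  exact: (fmorph_eq_rat (ht \o c2)).
rewrite /= /pair_pt; case: ifP => _.
  rewrite -[LHS]/((map_poly th 'X%:P).[t]) map_polyC hornerC.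
  by rewrite -[LHS]/((map_poly r 'X).[s]) map_polyX hornerX.
by rewrite -[LHS]/((map_poly th 'X).[t]) map_polyX hornerX.
Qed.

End Generic.

(** * Morphisms out of a field of fractions *)

Section FracExtend.
Variables (D : idomainType) (K : fieldType) (e : {rmorphism D -> K}).
Hypothesis e_inj : forall x, x != 0 -> e x != 0.

Lemma frac_quot (f : {fraction D}) : exists n d, d != 0 /\ f * tofrac d = tofrac n.
Proof.
exists (\n_(repr f)), (\d_(repr f)); split; first exact: denom_ratioP.
rewrite -{1}[f]reprK; move: (repr f) => x.
rewrite /FracField.tofrac; unlock.
rewrite -[LHS]FracField.pi_mul; apply/eqmodP.
rewrite /= FracField.equivfE /FracField.mulf.
by rewrite !numden_Ratio ?mulf_neq0 ?oner_eq0 ?denom_ratioP // !mulr1 mulrC.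
Qed.

(** The universal property of the field of fractions, with values in a field. *)
Lemma frac_extend : exists g : {rmorphism {fraction D} -> K}, forall x, g (tofrac x) = e x.
Proof.
have /choice[nd Hnd] : forall f : {fraction D}, exists nd : D * D,
    nd.2 != 0 /\ f * tofrac nd.2 = tofrac nd.1.
  by move=> f; have [n [d H]] := frac_quot f; exists (n, d).
pose g f : K := e (nd f).1 / e (nd f).2.
have gP f n d : d != 0 -> f * tofrac d = tofrac n -> g f = e n / e d.
  move=> dn0 fE; have [d0 f0] := Hnd f.
  have E : (nd f).1 * d = n * (nd f).2.
    by apply/eqP; rewrite -tofrac_eq !tofracM -fE -f0 mulrAC.
  apply: (canRL (mulfK (e_inj dn0))); rewrite /g mulrAC -rmorphM E rmorphM mulfK //.
  exact: e_inj.
have gt x : g (tofrac x) = e x.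
  by rewrite (gP _ x 1) ?oner_eq0 ?rmorph1 ?divr1 // mulr1.
have gA : zmod_morphism g.
  move=> f f'; have [d0 f0] := Hnd f; have [d0' f0'] := Hnd f'.
  rewrite (gP _ ((nd f).1 * (nd f').2 - (nd f').1 * (nd f).2) ((nd f).2 * (nd f').2)).
  - rewrite rmorphB !rmorphM /g; have := e_inj d0; have := e_inj d0'.
    by move: (e (nd f).2) (e (nd f').2) => a b b0 a0; field; rewrite ?a0 ?b0.
  - by rewrite mulf_neq0.
  by rewrite tofracB !tofracM -f0 -f0'; ring.
have gM : monoid_morphism g.
  split=> [|f f']; first by rewrite -tofrac1 gt rmorph1.
  have [d0 f0] := Hnd f; have [d0' f0'] := Hnd f'.
  rewrite (gP _ ((nd f).1 * (nd f').1) ((nd f).2 * (nd f').2)).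
  - rewrite !rmorphM /g; have := e_inj d0; have := e_inj d0'.
    by move: (e (nd f).2) (e (nd f').2) => a b b0 a0; field; rewrite ?a0 ?b0.
  - by rewrite mulf_neq0.
  by rewrite !tofracM -f0 -f0'; ring.
pose hA := GRing.isZmodMorphism.Build _ _ g gA.
pose hM := GRing.isMonoidMorphism.Build _ _ g gM.
pose G : {rmorphism {fraction D} -> K} := HB.pack g hA hM.
by exists G.
Qed.

End FracExtend.

(** * Skew matrices of size four and the Pfaffian *)

Section Skew.
Variable K : comNzRingType.

Definition mx4 (s : seq (seq K)) : 'M[K]_4 := \matrix_(i, j) nth 0 (nth [::] s i) j.

(** Case analysis on the index before the entries of a matrix are computed keeps
    the goals small. *)
Lemma ord4P (P : 'I_4 -> Prop) : P 0 -> P 1 -> P 2%:R -> P 3%:R -> forall i, P i.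
Proof.
move=> P0 P1 P2 P3 [[|[|[|[|i]]]] lti] //.
- by rewrite (_ : Ordinal lti = 0) //; apply: val_inj.
- by rewrite (_ : Ordinal lti = 1) //; apply: val_inj.
- by rewrite (_ : Ordinal lti = 2%:R) //; apply: val_inj.
- by rewrite (_ : Ordinal lti = 3%:R) //; apply: val_inj.
Qed.

Lemma mx4_delta (a b : 'I_4) : delta_mx a b =
  mx4 (mkseq (fun i => mkseq (fun j => ((i == a) && (j == b))%:R) 4) 4).
Proof. by apply/matrixP => i j; rewrite !mxE !nth_mkseq. Qed.

Lemma mx4_scalar a :
  a%:M = mx4 [:: [:: a; 0; 0; 0]; [:: 0; a; 0; 0]; [:: 0; 0; a; 0]; [:: 0; 0; 0; a]].
Proof. by apply/matrixP; apply: ord4P; apply: ord4P; rewrite !mxE. Qed.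

Lemma mx4_opp s : all (fun r : seq K => size r == 4) s -> - mx4 s = mx4 (map (map -%R) s).
Proof.
move=> s4; apply/matrixP => i j; rewrite !mxE.
have [is_|si] := ltnP i (size s); last by rewrite !(nth_default [::]) ?size_map // !nth_nil oppr0.
have /(allP s4)/eqP s4i := mem_nth [::] is_.
by rewrite (nth_map [::]) // (nth_map 0) // s4i.
Qed.

(** Products are computed once, on symbolic entries. *)
Lemma mx4_mul a00 a01 a02 a03 a10 a11 a12 a13 a20 a21 a22 a23 a30 a31 a32 a33
    b00 b01 b02 b03 b10 b11 b12 b13 b20 b21 b22 b23 b30 b31 b32 b33 :
  mx4 [:: [:: a00; a01; a02; a03];
           [:: a10; a11; a12; a13];
           [:: a20; a21; a22; a23];
           [:: a30; a31; a32; a33]] *m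
  mx4 [:: [:: b00; b01; b02; b03];
           [:: b10; b11; b12; b13];
           [:: b20; b21; b22; b23];
           [:: b30; b31; b32; b33]] =
  mx4 [:: [:: a00 * b00 + a01 * b10 + a02 * b20 + a03 * b30;
          a00 * b01 + a01 * b11 + a02 * b21 + a03 * b31;
          a00 * b02 + a01 * b12 + a02 * b22 + a03 * b32;
          a00 * b03 + a01 * b13 + a02 * b23 + a03 * b33];
      [:: a10 * b00 + a11 * b10 + a12 * b20 + a13 * b30;
          a10 * b01 + a11 * b11 + a12 * b21 + a13 * b31;
          a10 * b02 + a11 * b12 + a12 * b22 + a13 * b32;
          a10 * b03 + a11 * b13 + a12 * b23 + a13 * b33];
      [:: a20 * b00 + a21 * b10 + a22 * b20 + a23 * b30;
          a20 * b01 + a21 * b11 + a22 * b21 + a23 * b31;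
          a20 * b02 + a21 * b12 + a22 * b22 + a23 * b32;
          a20 * b03 + a21 * b13 + a22 * b23 + a23 * b33];
      [:: a30 * b00 + a31 * b10 + a32 * b20 + a33 * b30;
          a30 * b01 + a31 * b11 + a32 * b21 + a33 * b31;
          a30 * b02 + a31 * b12 + a32 * b22 + a33 * b32;
          a30 * b03 + a31 * b13 + a32 * b23 + a33 * b33]].
Proof.
apply/matrixP => i j; rewrite !mxE !big_ord_recl big_ord0 addr0 !mxE.
by move: i j; apply: ord4P; apply: ord4P; rewrite /= !addrA.
Qed.

Definition skew4 (a b c d e f : K) : 'M[K]_4 :=
  mx4 [:: [:: 0; a; b; c]; [:: - a; 0; d; e]; [:: - b; - d; 0; f]; [:: - c; - e; - f; 0]].

(** The coordinates are the entries above the diagonal, in the order 12, 13, 14,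
    23, 24, 34. *)
Definition pskew (p : 'rV[K]_6) : 'M[K]_4 :=
  skew4 (p 0 0) (p 0 1) (p 0 2%:R) (p 0 3%:R) (p 0 4%:R) (p 0 5%:R).

(** The Pfaffian adjoint, which satisfies
    [pskew p *m dskew p = (pfaff p)%:M]. *)
Definition dskew (p : 'rV[K]_6) : 'M[K]_4 :=
  skew4 (- p 0 5%:R) (p 0 4%:R) (- p 0 3%:R) (- p 0 2%:R) (p 0 1) (- p 0 0).

Definition pfaff (p : 'rV[K]_6) : K :=
  p 0 0 * p 0 5%:R - p 0 1 * p 0 4%:R + p 0 2%:R * p 0 3%:R.

Lemma pskew_dskew p : pskew p *m dskew p = (pfaff p)%:M.
Proof.
rewrite mx4_mul mx4_scalar /pfaff.
by congr (mx4 [:: [:: _; _; _; _]; [:: _; _; _; _]; [:: _; _; _; _]; [:: _; _; _; _]]);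
  ring.
Qed.

Lemma dskew_pskew p : dskew p *m pskew p = (pfaff p)%:M.
Proof.
rewrite mx4_mul mx4_scalar /pfaff.
by congr (mx4 [:: [:: _; _; _; _]; [:: _; _; _; _]; [:: _; _; _; _]; [:: _; _; _; _]]);
  ring.
Qed.

Lemma skew4_linear k a b c d e f a' b' c' d' e' f' :
  skew4 (k * a + a') (k * b + b') (k * c + c') (k * d + d') (k * e + e') (k * f + f')
  = k *: skew4 a b c d e f + skew4 a' b' c' d' e' f'.
Proof.
by apply/matrixP; apply: ord4P; apply: ord4P; rewrite !mxE /=; ring.
Qed.

Lemma pskew_linear : linear pskew.
Proof. by move=> k p q; rewrite -skew4_linear /pskew !mxE. Qed.

Lemma dskew_linear : linear dskew.
Proof.
by move=> k p q; rewrite -skew4_linear /dskew !mxE !opprD !mulrN.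
Qed.

Definition bvec k c : 'rV[K]_6 := \row_i (if val i == k then c else 0).

Local Ltac elementary := rewrite /pskew /dskew !mxE /= !mx4_mul mx4_delta /mkseq /=;
  rewrite ?mx4_opp //= !(mul0r, mulr0, mul1r, mulr1, oppr0, opprK, add0r, addr0, mulN1r);
  reflexivity.

(** With [{a, b, c, d}] the four indices, the skew matrices supported on [ac]
    and [ad] do it: the adjoint of the second is supported on [bc], and the
    product of the supports [ac] and [cb] is the entry [ab]. *)
Lemma skew_elementary (a b : 'I_4) : a != b -> exists p p',
  pskew p *m dskew p' = delta_mx a b /\ dskew p *m pskew p' = - delta_mx b a.
Proof.
move: a b; apply: ord4P; apply: ord4P => //= _.
- exists (bvec 1 1), (bvec 2 (1)); split; elementary.
- exists (bvec 0 1), (bvec 2 (-1)); split; elementary.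
- exists (bvec 0 1), (bvec 1 (1)); split; elementary.
- exists (bvec 3 1), (bvec 4 (-1)); split; elementary.
- exists (bvec 0 1), (bvec 4 (-1)); split; elementary.
- exists (bvec 0 1), (bvec 3 (1)); split; elementary.
- exists (bvec 3 1), (bvec 5 (-1)); split; elementary.
- exists (bvec 1 1), (bvec 5 (1)); split; elementary.
- exists (bvec 1 1), (bvec 3 (1)); split; elementary.
- exists (bvec 4 1), (bvec 5 (-1)); split; elementary.
- exists (bvec 2 1), (bvec 5 (1)); split; elementary.
- exists (bvec 2 1), (bvec 4 (-1)); split; elementary.
Qed.

End Skew.

(** * Forms of signature (3, 3) as Pfaffians *)

Lemma sum_ord6 (V : nmodType) (F : 'I_6 -> V) :
  \sum_i F i = F 0 + F 1 + F 2%:R + F 3%:R + F 4%:R + F 5%:R.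
Proof.
rewrite !big_ord_recl big_ord0 addr0 !addrA.
by congr (F _ + F _ + F _ + F _ + F _ + F _); apply: val_inj.
Qed.

Section PfaffianCoordinates.
Variable R : rcfType.

(** The change of coordinates from a sum of three hyperbolic planes
    [y_k ^ 2 - y_(k + 3) ^ 2] to the three terms of the Pfaffian. *)
Definition hyp_tab : seq (seq R) :=
  [:: [:: 1; 0; 0; 0; 0; 1]; [:: 0; 1; 0; 0; -1; 0]; [:: 0; 0; 1; 1; 0; 0];
      [:: 1; 0; 0; 0; 0; -1]; [:: 0; 1; 0; 0; 1; 0]; [:: 0; 0; 1; -1; 0; 0]].
Definition hyp_mx : 'M[R]_6 := \matrix_(i, k) nth 0 (nth [::] hyp_tab i) k.

Lemma hyp_mxE (y : 'rV[R]_6) (p := y *m hyp_mx) :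
  [/\ p 0 0 = y 0 0 + y 0 3%:R, p 0 1 = y 0 1 + y 0 4%:R,
      p 0 2%:R = y 0 2%:R + y 0 5%:R &
   [/\ p 0 3%:R = y 0 2%:R - y 0 5%:R, p 0 4%:R = y 0 4%:R - y 0 1
    & p 0 5%:R = y 0 0 - y 0 3%:R]].
Proof. by rewrite /p; split; [..|split]; rewrite mxE sum_ord6 !mxE /=; ring. Qed.

Lemma hyp_mx_unit : hyp_mx \in unitmx.
Proof.
rewrite -row_free_unit -kermx_eq0; apply/rowV0P => y /sub_kermxP y0.
have [] := hyp_mxE y; rewrite y0 !mxE => e0 e1 e2 [e3 e4 e5].
apply/rowP => i; rewrite mxE.
case: i => [[|[|[|[|[|[|//]]]]]] lti].
- by rewrite (_ : Ordinal lti = 0); [lra | apply: val_inj].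
- by rewrite (_ : Ordinal lti = 1); [lra | apply: val_inj].
- by rewrite (_ : Ordinal lti = 2%:R); [lra | apply: val_inj].
- by rewrite (_ : Ordinal lti = 3%:R); [lra | apply: val_inj].
- by rewrite (_ : Ordinal lti = 4%:R); [lra | apply: val_inj].
- by rewrite (_ : Ordinal lti = 5%:R); [lra | apply: val_inj].
Qed.

Lemma pfaff_coords (A : 'M[R]_6) : split_sign A ->
  exists2 L, L \in unitmx & forall v, quadf A v = pfaff (v *m L).
Proof.
case/split_signP => F Fu EF.
exists (invmx F *m hyp_mx); first by rewrite unitmx_mul unitmx_inv Fu hyp_mx_unit.
move=> v; have [y ->] : exists y, v = y *m F by exists (v *m invmx F); rewrite mulmxKV.
rewrite mulmxA mulmxK //.
rewrite quadf_mul EF quadf_diag sum_ord6 !mxE /= !expr0 !expr1 /pfaff.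
by have [-> -> -> [-> -> ->]] := hyp_mxE y; ring.
Qed.

End PfaffianCoordinates.

(** Matrices over [L] as a [K]-algebra, by restriction of scalars along [em].  A
    separate name keeps this structure apart from the [L]-algebra structure on
    the same type. *)
Definition restr_mx (K L : fieldType) (em : {rmorphism K -> L}) (n : nat) : Type :=
  'M[L]_n.+1.

Section RestrMx.
Variables (K L : fieldType) (em : {rmorphism K -> L}) (n : nat).
Local Notation V := (restr_mx em n).

HB.instance Definition _ := GRing.NzRing.copy V 'M[L]_n.+1.

Definition restr_scale (a : K) (x : V) : V := em a *: (x : 'M[L]_n.+1).

Fact restr_scaleA a b x : restr_scale a (restr_scale b x) = restr_scale (a * b) x.
Proof. by rewrite /restr_scale scalerA rmorphM. Qed.
Fact restr_scale1 : left_id 1 restr_scale.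
Proof. by move=> x; rewrite /restr_scale rmorph1 scale1r. Qed.
Fact restr_scaleDr : right_distributive restr_scale +%R.
Proof. by move=> a x y; rewrite /restr_scale scalerDr. Qed.
Fact restr_scaleDl x : {morph restr_scale^~ x : a b / a + b}.
Proof. by move=> a b; rewrite /restr_scale rmorphD scalerDl. Qed.
Fact restr_scaleAl a (x y : V) : restr_scale a (x * y) = restr_scale a x * y.
Proof. by rewrite /restr_scale -[RHS]scalerAl. Qed.
Fact restr_scaleAr a (x y : V) : restr_scale a (x * y) = x * restr_scale a y.
Proof. by rewrite /restr_scale -[RHS]scalerAr. Qed.

HB.instance Definition _ := GRing.Zmodule_isLmodule.Build K V
  restr_scaleA restr_scale1 restr_scaleDr restr_scaleDl.
HB.instance Definition _ := GRing.Lmodule_isLalgebra.Build K V restr_scaleAl.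
HB.instance Definition _ := GRing.Lalgebra_isAlgebra.Build K V restr_scaleAr.

Lemma restr_scaleE (a : K) (x : V) : a *: x = em a *: (x : 'M[L]_n.+1) :> 'M[L]_n.+1.
Proof. by []. Qed.

End RestrMx.

(** * Linear spans and even words in a Clifford algebra *)

Section LinearSpan.
Variables (K : nzRingType) (V : lmodType K).

(** An inductive span, so that closure properties are proved without naming
    coefficients. *)
Inductive lspan (S : V -> Prop) : V -> Prop :=
| lspan0 : lspan S 0
| lspan_cons a x y : S x -> lspan S y -> lspan S (a *: x + y).

Lemma lspan_mem S x : S x -> lspan S x.
Proof.
move=> Sx; rewrite -[x]scale1r -[X in lspan S X]addr0.
exact: lspan_cons Sx (lspan0 _).
Qed.

Lemma lspanD S x y : lspan S x -> lspan S y -> lspan S (x + y).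
Proof.
move=> Sx Sy; elim: Sx => [|a u v Su _ IH]; first by rewrite add0r.
by rewrite -addrA; apply: lspan_cons.
Qed.

Lemma lspanZ S a x : lspan S x -> lspan S (a *: x).
Proof.
elim=> [|b u v Su _ IH]; first by rewrite scaler0; apply: lspan0.
by rewrite scalerDr scalerA; apply: lspan_cons.
Qed.

Lemma lspanB S x y : lspan S x -> lspan S y -> lspan S (x - y).
Proof. by move=> Sx Sy; rewrite -scaleN1r; apply: lspanD => //; apply: lspanZ. Qed.

Lemma lspan_sum S (I : Type) (r : seq I) (F : I -> V) :
  (forall i, lspan S (F i)) -> lspan S (\sum_(i <- r) F i).
Proof. by move=> H; apply: big_ind => //; [apply: lspan0 | apply: lspanD]. Qed.

Lemma lspan_ind_lin S (P : V -> Prop) : P 0 ->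
  (forall a x y, P x -> P y -> P (a *: x + y)) -> (forall x, S x -> P x) ->
  forall x, lspan S x -> P x.
Proof. by move=> P0 PD PS x; elim=> // a u v Su _ Pv; apply: PD Pv; apply: PS. Qed.

Lemma lspan_sub S S' x : (forall y, S y -> lspan S' y) -> lspan S x -> lspan S' x.
Proof.
move=> SS'; apply: lspan_ind_lin => // [|a u v Su Sv]; first exact: lspan0.
by apply: lspanD Sv; apply: lspanZ.
Qed.

Lemma lspan_seq (s : seq V) x : lspan (fun y => y \in s) x ->
  exists c : 'rV[K]_(size s), x = \sum_i c 0 i *: s`_i.
Proof.
elim=> [|a u v us _ [c ->]].
  by exists 0; rewrite big1 // => i _; rewrite mxE scale0r.
have lt_is : (index u s < size s)%N by rewrite index_mem.
exists (a *: delta_mx 0 (Ordinal lt_is) + c).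
under [RHS]eq_bigr do rewrite !mxE scalerDl.
rewrite [RHS]big_split /=; congr (_ + _).
rewrite (bigD1 (Ordinal lt_is)) //= !eqxx mulr1 nth_index // big1 ?addr0 // => i /negPf ni.
by rewrite ni mulr0 scale0r.
Qed.

End LinearSpan.

(** The matrix of coefficients has more rows than columns, hence a nonzero row
    kernel. *)
Lemma lspan_dep (K : fieldType) (V : lmodType K) (J : finType) (s : seq V) (u : J -> V) :
  (forall j, lspan (fun y => y \in s) (u j)) -> (size s < #|J|)%N ->
  exists c : J -> K, (exists j, c j != 0) /\ \sum_j c j *: u j = 0.
Proof.
move=> us ltJ.
have /choice[a Ha] j : exists c : 'rV[K]_(size s), u j = \sum_i c 0 i *: s`_i.
  exact: lspan_seq.
pose A := \matrix_(i < #|J|) a (enum_val i).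
have : kermx A != 0.
  rewrite kermx_eq0 -row_leq_rank -ltnNge; apply: leq_ltn_trans ltJ.
  exact: rank_leq_col.
case/rowV0Pn => c /sub_kermxP cA /rV0Pn[k ck].
exists (fun j => c 0 (enum_rank j)); split.
  by exists (enum_val k); rewrite enum_valK.
under eq_bigr do rewrite Ha scaler_sumr.
rewrite exchange_big big1 //= => i _.
under eq_bigr do rewrite scalerA.
rewrite -scaler_suml.
suff -> : \sum_j c 0 (enum_rank j) * a j 0 i = 0 by rewrite scale0r.
move/rowP: cA => /(_ i); rewrite !mxE => cAi; rewrite -[RHS]cAi.
rewrite (reindex (fun k : 'I_#|J| => enum_val k)) /=; last first.
  by exists enum_rank => j _; [exact: enum_valK | exact: enum_rankK].
by apply: eq_bigr => l _; rewrite enum_valK !mxE.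
Qed.

Section EvenPart.
Variables (K : fieldType) (n : nat) (C : algType K) (g : {linear 'rV[K]_n -> C}).

Local Notation prodg l := (\prod_(v <- l) g v).

Lemma even_prod l : ~~ odd (size l) -> even_part g (prodg l).
Proof. by move=> el; exists [:: (1, l)]; rewrite /= ?el // big_seq1 scale1r. Qed.

Lemma even_spanE x : even_part g x <->
  lspan (fun y => exists2 l, ~~ odd (size l) & y = prodg l) x.
Proof.
split=> [[s es ->]|].
  elim: s es => [|t s IHs]; first by rewrite big_nil => _; apply: lspan0.
  by case/andP=> et /IHs; rewrite big_cons; apply: lspan_cons; exists t.2.
apply: lspan_ind_lin => [||_ [l el ->]]; last exact: even_prod.
  by exists [::]; rewrite ?big_nil.
move=> a y z [s es ->] [s' es' ->].
exists ([seq (a * t.1, t.2) | t <- s] ++ s').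
  by rewrite all_cat es' andbT all_map; apply: sub_all es.
rewrite big_cat big_map scaler_sumr; congr (_ + _).
by apply: eq_bigr => t _; rewrite scalerA.
Qed.

Lemma even_lin a x y : even_part g x -> even_part g y -> even_part g (a *: x + y).
Proof.
move=> /even_spanE ex /even_spanE ey; apply/even_spanE.
by apply: lspanD ey; apply: lspanZ.
Qed.

Lemma even_mul x y : even_part g x -> even_part g y -> even_part g (x * y).
Proof.
move=> /even_spanE ex ey; move: x ex; apply: lspan_ind_lin.
- by rewrite mul0r; exists [::]; rewrite ?big_nil.
- by move=> a u v eu ev; rewrite mulrDl -scalerAl; apply: even_lin.
move=> _ [l el ->]; move/even_spanE: ey; move: y; apply: lspan_ind_lin.
- by rewrite mulr0; exists [::]; rewrite ?big_nil.
- by move=> a u v eu ev; rewrite mulrDr -scalerAr; apply: even_lin.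
move=> _ [l' el' ->]; rewrite -big_cat; apply: even_prod.
by rewrite size_cat oddD (negPf el) (negPf el').
Qed.

Lemma even1 : even_part g 1.
Proof. by have := @even_prod [::] isT; rewrite big_nil. Qed.

Lemma even0 : even_part g 0.
Proof. by exists [::]; rewrite ?big_nil. Qed.

Lemma even_pair u v : even_part g (g u * g v).
Proof. by have := @even_prod [:: u; v] isT; rewrite !big_cons big_nil mulr1. Qed.

Hypothesis sq : forall v, exists c, g v * g v = c%:A.

Lemma anticomm u v : exists c, g u * g v = c%:A - g v * g u.
Proof.
have [a Ea] := sq u; have [b Eb] := sq v; have [c] := sq (u + v).
rewrite linearD mulrDl !mulrDr Ea Eb => Ec; exists (c - a - b).
by rewrite !scalerBl -Ec -(addrA a%:A) (addrC a%:A) addrK addrA !addrK.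
Qed.

(** Ordered monomials in the vectors of [l], the even ones first and the odd
    ones second. *)
Fixpoint monomials (l : seq 'rV[K]_n) : seq C * seq C :=
  if l is v :: l' then
    let: (Ev, Od) := monomials l' in
    (Ev ++ [seq y * g v | y <- Od], Od ++ [seq y * g v | y <- Ev])
  else ([:: 1], [::]).

Local Notation spanE l := (lspan (fun y => y \in (monomials l).1)).
Local Notation spanO l := (lspan (fun y => y \in (monomials l).2)).

Lemma size_monomials v l : (size (monomials (v :: l)).1 = 2 ^ size l)%N.
Proof.
have sum w : (size (monomials w).1 + size (monomials w).2 = 2 ^ size w)%N.
  elim: w => //= v' w; case: (monomials w) => Ev Od /= IH.
  by rewrite !size_cat !size_map expnS -IH; lia.
by rewrite /= -sum; case: (monomials l) => Ev Od /=; rewrite size_cat size_map.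
Qed.

(** Anticommutation, up to a scalar, moves [u] to its place.  The scalars left
    over multiply shorter monomials, which have the right parity. *)
Lemma monomials_mul l u : u \in l -> forall y,
  (spanE l y -> spanO l (y * g u)) /\ (spanO l y -> spanE l (y * g u)).
Proof.
elim: l => //= v l; case EO: (monomials l) => [Ev Od] /= IH ul.
have linmul (S S' : C -> Prop) : (forall y, S y -> lspan S' (y * g u)) ->
    forall y, lspan S y -> lspan S' (y * g u).
  move=> H; apply: lspan_ind_lin => //; first by rewrite mul0r; apply: lspan0.
  by move=> a x y Sx Sy; rewrite mulrDl -scalerAl; apply: lspanD Sy; apply: lspanZ.
have sub (s s' : seq C) y : {subset s <= s'} ->
    lspan (fun z => z \in s) y -> lspan (fun z => z \in s') y.
  by move=> ss'; apply: lspan_sub => z /ss' zs'; apply: lspan_mem.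
have catl (s s' : seq C) : {subset s <= s ++ s'} by move=> z; rewrite mem_cat => ->.
have mulv (s s' : seq C) y : lspan (fun z => z \in s) y ->
    lspan (fun z => z \in s' ++ [seq y * g v | y <- s]) (y * g v).
  move: y; apply: lspan_ind_lin => [|a x y Sx Sy|x xs].
  - by rewrite mul0r; apply: lspan0.
  - by rewrite mulrDl -scalerAl; apply: lspanD Sy; apply: lspanZ.
  apply: lspan_mem; rewrite mem_cat; apply/orP; right.
  exact: (map_f (fun y => y * g v)).
have [c gvv] := sq v.
(* The two parities are treated alike, with [A] and [B] exchanged. *)
suff half A B : (forall y, lspan (fun z => z \in A) y -> u \in l ->
      lspan (fun z => z \in B) (y * g u)) ->
    (forall y, lspan (fun z => z \in B) y -> u \in l -> lspan (fun z => z \in A) (y * g u)) ->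
    forall y, lspan (fun z => z \in A ++ [seq y * g v | y <- B]) y ->
      lspan (fun z => z \in B ++ [seq y * g v | y <- A]) (y * g u).
  by move=> y; split; apply: half => z Sz ul'; have [H1 H2] := IH ul' z;
    [exact: H1 | exact: H2 | exact: H2 | exact: H1].
move=> AB BA; apply: linmul => y; rewrite mem_cat => /orP[yA|].
  move: ul; rewrite inE => /predU1P[->|ul]; first exact/mulv/lspan_mem.
  by apply: sub (catl _ _) _; apply: AB ul; apply: lspan_mem.
case/seq.mapP => z zB ->.
have Sz := lspan_mem (S := fun z => z \in B) zB.
move: ul; rewrite inE => /predU1P[->|ul].
  by rewrite -mulrA gvv -scalerAr mulr1; apply: lspanZ; apply: sub (catl _ _) Sz.
have [d ->] : exists d, z * g v * g u = d *: z - z * g u * g v.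
  have [d gvu] := anticomm v u; exists d.
  by rewrite -!mulrA gvu mulrBr -scalerAr mulr1.
apply: lspanB; first by apply: lspanZ; apply: sub (catl _ _) Sz.
by apply: mulv; apply: BA.
Qed.

(** Each factor [g v] exchanges the spans of the even and of the odd
    monomials. *)
Lemma even_part_span (l : seq 'rV[K]_n) x :
  (forall v, exists c : 'rV[K]_n -> K, v = \sum_(u <- l) c u *: u) ->
  even_part g x -> spanE l x.
Proof.
move=> lgen /even_spanE; apply: lspan_sub => _ [s es ->].
have linmul (S S' : C -> Prop) v : (forall u y, u \in l -> lspan S y -> lspan S' (y * g u)) ->
    forall y, lspan S y -> lspan S' (y * g v).
  move=> H y Sy; have [c ->] := lgen v.
  rewrite linear_sum mulr_sumr big_seq; apply: big_ind => [|?? | u ul].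
  - exact: lspan0.
  - exact: lspanD.
  by rewrite linearZ -scalerAr; apply: lspanZ; apply: H.
have one : spanE l 1.
  apply: lspan_mem; elim: l {lgen linmul} => [|v l]; first by rewrite /= inE.
  rewrite /=; case: (monomials l) => Ev Od /=.
  by rewrite mem_cat => ->.
suff [+ _] : (~~ odd (size s) -> spanE l (prodg s)) /\ (odd (size s) -> spanO l (prodg s)) by apply.
elim/last_ind: s {es} => [|s v [IHe IHo]]; first by rewrite big_nil.
rewrite size_rcons /= negbK -cats1 big_cat big_seq1; split => h.
  apply: (linmul _ _ v _ _ (IHo h)) => u y ul Sy.
  by have [_] := monomials_mul ul y; apply.
apply: (linmul _ _ v _ _ (IHe h)) => u y ul Sy.
by have [+ _] := monomials_mul ul y; apply.
Qed.

End EvenPart.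

(** * Quadratic algebras *)

Section QuadraticAlgebra.
Variables (K : fieldType) (d : K).

Local Notation hq := ('X^2 + d%:P : {poly K}).
Local Notation Qd := {poly %/ 'X^2 + d%:P}.

Lemma size_quad : size hq = 3%N.
Proof. by rewrite size_polyDl size_polyXn // (leq_ltn_trans (size_polyC_leq1 _)). Qed.

Lemma monic_quad : hq \is monic.
Proof.
by rewrite monicE lead_coefDl ?lead_coefXn // size_polyXn (leq_ltn_trans (size_polyC_leq1 _)).
Qed.

Lemma quad_mk_monic : mk_monic hq = hq.
Proof. by rewrite /mk_monic size_quad monic_quad. Qed.

Lemma quad_valX : ('qX : Qd) = 'X :> {poly K}.
Proof. by rewrite qpolyXE ?size_quad ?monic_quad. Qed.

Lemma quad_val (c0 c1 : K) : (c0%:A + c1 *: 'qX : Qd) = c0%:P + c1 *: 'X :> {poly K}.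
Proof.
by rewrite poly_of_qpolyD !poly_of_qpolyZ quad_valX -[c0 in RHS]mulr1 -scale_polyC.
Qed.

Lemma quad_decomp (l : Qd) : exists c0 c1, l = c0%:A + c1 *: 'qX.
Proof.
exists (l : {poly K})`_0, (l : {poly K})`_1; apply: val_inj.
apply: etrans (esym (quad_val _ _)).
have sl : (size (l : {poly K}) <= 2)%N.
  by apply: leq_trans (size_npoly l) _; rewrite quad_mk_monic size_quad.
apply/polyP => i; rewrite !(coefD, coefC, coefZ, coefX).
by case: i => [|[|i]] /=; rewrite ?mulr0 ?mulr1 ?addr0 ?add0r // nth_default // (leq_trans sl).
Qed.

Lemma quad_indep (c0 c1 : K) : (c0%:A + c1 *: 'qX : Qd) = 0 -> c0 = 0 /\ c1 = 0.
Proof.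
move=> l0; have : c0%:P + c1 *: 'X = 0 :> {poly K} by rewrite -quad_val l0.
move=> /polyP h; have := h 0%N; have := h 1%N.
rewrite !coef0 !(coefD, coefC, coefZ, coefX) /=.
by rewrite !mulr0 !mulr1 addr0 add0r.
Qed.

Lemma quad_sqr : ('qX * 'qX : Qd) = (- d)%:A.
Proof.
have h0 : in_qpoly hq hq = 0.
  by apply: val_inj; rewrite /= quad_mk_monic Pdiv.RingMonic.rmodpp // monic_quad.
have E1 : in_qpoly hq 'X^2 = 'qX * 'qX by apply: (in_qpolyM hq 'X 'X).
have E2 : in_qpoly hq d%:P = d%:A.
  apply: etrans (congr1 (in_qpoly hq) (esym (alg_polyC d))) _.
  by rewrite in_qpolyZ in_qpoly1.
by apply/eqP; rewrite -E1 scaleNr -E2 -addr_eq0 -in_qpolyD h0.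
Qed.

End QuadraticAlgebra.

(** * The Clifford algebra over the reals *)

Section BlockMatrices.
Variable K : comNzRingType.

Definition diag2 (Y Z : 'M[K]_4) : 'M[K]_8 := block_mx Y 0 0 Z : 'M_(4 + 4).
Definition anti2 (Y Z : 'M[K]_4) : 'M[K]_8 := block_mx 0 Y Z 0 : 'M_(4 + 4).
Definition ul4 (X : 'M[K]_8) : 'M[K]_4 := ulsubmx (X : 'M_(4 + 4)).
Definition dr4 (X : 'M[K]_8) : 'M[K]_4 := drsubmx (X : 'M_(4 + 4)).

Lemma ul4_diag2 Y Z : ul4 (diag2 Y Z) = Y. Proof. exact: block_mxKul. Qed.
Lemma dr4_diag2 Y Z : dr4 (diag2 Y Z) = Z. Proof. exact: block_mxKdr. Qed.

Lemma diag2_mul Y Z Y' Z' : diag2 Y Z * diag2 Y' Z' = diag2 (Y *m Y') (Z *m Z').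
Proof.
rewrite /diag2 -mulmxE [LHS](@mulmx_block _ 4 4 4 4 4 4).
by rewrite !(mul0mx, mulmx0, addr0, add0r).
Qed.

Lemma anti2_mul Y Z Y' Z' : anti2 Y Z * anti2 Y' Z' = diag2 (Y *m Z') (Z *m Y').
Proof.
rewrite /anti2 -mulmxE [LHS](@mulmx_block _ 4 4 4 4 4 4).
by rewrite !(mul0mx, mulmx0, addr0, add0r).
Qed.

Lemma anti2_diag2 Y Z Y' Z' : anti2 Y Z * diag2 Y' Z' = anti2 (Y *m Z') (Z *m Y').
Proof.
rewrite /anti2 /diag2 -mulmxE [LHS](@mulmx_block _ 4 4 4 4 4 4).
by rewrite !(mul0mx, mulmx0, addr0, add0r).
Qed.

Lemma diag2_scalar a : diag2 a%:M a%:M = a%:M.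
Proof. by rewrite /diag2 -(@scalar_mx_block _ 4 4). Qed.

Lemma diag2D Y Z Y' Z' : diag2 Y Z + diag2 Y' Z' = diag2 (Y + Y') (Z + Z').
Proof. by rewrite /diag2 [LHS](@add_block_mx _ 4 4 4 4) !addr0. Qed.

Lemma diag2Z a Y Z : a *: diag2 Y Z = diag2 (a *: Y) (a *: Z).
Proof. by rewrite /diag2 [LHS](@scale_block_mx _ 4 4 4 4) !scaler0. Qed.

Lemma anti2D Y Z Y' Z' : anti2 Y Z + anti2 Y' Z' = anti2 (Y + Y') (Z + Z').
Proof. by rewrite /anti2 [LHS](@add_block_mx _ 4 4 4 4) !addr0. Qed.

Lemma anti2Z a Y Z : a *: anti2 Y Z = anti2 (a *: Y) (a *: Z).
Proof. by rewrite /anti2 [LHS](@scale_block_mx _ 4 4 4 4) !scaler0. Qed.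

(** Commuting with the elementary matrices of the first column is enough. *)
Lemma comm_scalar_mx n (X : 'M[K]_n.+1) :
  (forall Y, X *m Y = Y *m X) -> X = (X 0 0)%:M.
Proof.
move=> XY; apply/matrixP => a b.
have /matrixP := XY (delta_mx b 0) => /(_ a 0).
rewrite [LHS]mxE [RHS]mxE (bigD1 b) //= mxE !eqxx mulr1 big1 ?addr0; last first.
  by move=> k /negPf kb; rewrite mxE kb mulr0.
move=> ->; rewrite (bigD1 0) //= !mxE eqxx andbT big1 ?addr0; last first.
  by move=> k /negPf kb; rewrite mxE kb andbF mul0r.
by case: eqP => _; rewrite ?mul1r ?mul0r.
Qed.

Definition phi8 (p : 'rV[K]_6) : 'M[K]_8 := anti2 (pskew p) (dskew p).

Lemma phi8_linear : linear phi8.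
Proof. by move=> k p q; rewrite /phi8 pskew_linear dskew_linear anti2Z anti2D. Qed.

Lemma phi8_sum (I : finType) (c : I -> K) (v : I -> 'rV[K]_6) :
  phi8 (\sum_i c i *: v i) = \sum_i c i *: phi8 (v i).
Proof.
have phi0 : phi8 0 = 0.
  by have := phi8_linear (-1) 0 0; rewrite scaler0 addr0 scaleN1r addNr.
apply: (big_ind2 (fun x y => phi8 x = y)) => // [x _ y _ <- <-|i _].
  by rewrite -[x in LHS]scale1r phi8_linear scale1r.
by rewrite -[_ *: _ in LHS]addr0 phi8_linear phi0 addr0.
Qed.

Lemma phi8_sqr p : phi8 p * phi8 p = (pfaff p)%:M.
Proof. by rewrite anti2_mul pskew_dskew dskew_pskew diag2_scalar. Qed.

End BlockMatrices.

Section CliffordReal.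
Variables (R : rcfType) (K : fieldType) (em : {rmorphism K -> R}).
Variables (A : 'M[K]_6) (C : algType K) (g : {linear 'rV[K]_6 -> C}).
Hypothesis A_split : split_sign (map_mx em A).
Hypothesis g_cliff : is_clifford A g.

Lemma map_quadf v : quadf (map_mx em A) (map_mx em v) = em (quadf A v).
Proof. by rewrite /quadf map_trmx -!map_mxM mxE. Qed.

(** The universal property of the Clifford algebra is used for a target that is
    an algebra over the base field only through [em]. *)
Lemma clifford_real : exists (L : 'M[R]_6) (h : {lrmorphism C -> restr_mx em 7}),
  L \in unitmx /\ forall v, h (g v) = phi8 (map_mx em v *m L).
Proof.
have [L Lu qL] := pfaff_coords A_split.
pose f (v : 'rV[K]_6) : restr_mx em 7 := phi8 (map_mx em v *m L).
have f_lin : linear f.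
  move=> k u v; rewrite /f map_mxD map_mxZ mulmxDl -scalemxAl phi8_linear.
  by rewrite -restr_scaleE.
pose fL := GRing.isLinear.Build K _ _ _ f f_lin.
pose F : {linear 'rV[K]_6 -> restr_mx em 7} := HB.pack f fL.
have [|h [hg _]] := g_cliff.2 _ F.
  move=> v; rewrite /= [LHS]phi8_sqr -qL map_quadf.
  by rewrite -scalemx1 -[RHS]restr_scaleE.
by exists L, h.
Qed.

Variables (L : 'M[R]_6) (h : {lrmorphism C -> restr_mx em 7}).
Hypotheses (Lu : L \in unitmx) (hg : forall v, h (g v) = phi8 (map_mx em v *m L)).

Lemma specM x y : h (x * y) = (h x : 'M[R]_8) * (h y : 'M[R]_8).
Proof. exact: rmorphM. Qed.

Definition psi1 x := ul4 (h x).
Definition psi2 x := dr4 (h x).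

(** The images of vectors are off-diagonal, so even products are diagonal. *)
Lemma even_diag2 x : even_part g x -> h x = diag2 (psi1 x) (psi2 x).
Proof.
suff H : even_part g x -> exists Y Z, h x = diag2 Y Z.
  by case/H => Y [Z E]; rewrite /psi1 /psi2 E ul4_diag2 dr4_diag2.
move/even_spanE; move: x; apply: lspan_ind_lin.
- exists 0, 0; rewrite rmorph0; have := @diag2_scalar R 0.
  by rewrite !raddf0 => ->.
- move=> a x y [Y [Z E]] [Y' [Z' E']]; exists (em a *: Y + Y'), (em a *: Z + Z').
  by rewrite linearD linearZ /= [X in X + _]restr_scaleE E E' -diag2D diag2Z.
move=> _ [l el ->].
have : (~~ odd (size l) -> exists Y Z, h (\prod_(v <- l) g v) = diag2 Y Z) /\
       (odd (size l) -> exists Y Z, h (\prod_(v <- l) g v) = anti2 Y Z).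
  elim: l {el} => [|v l [IHe IHo]].
    by split=> // _; exists 1%:M, 1%:M; rewrite big_nil rmorph1 diag2_scalar.
  rewrite big_cons specM hg /= negbK; split.
    by move=> /IHo [Y [Z ->]]; eexists; eexists; rewrite /phi8 anti2_mul.
  by move=> /IHe [Y [Z ->]]; eexists; eexists; rewrite /phi8 anti2_diag2.
by case=> + _; apply.
Qed.

(** The span over [R] of the image of the even part, which is only a [K]-space. *)
Definition evspan : 'M[R]_8 -> Prop :=
  lspan (fun X : 'M[R]_8 => exists2 x, even_part g x & X = (h x : 'M[R]_8)).

Lemma evspan_mul X Y : evspan X -> evspan Y -> evspan (X * Y).
Proof.
move=> SX SY; elim: SX => [|a _ U [x ex ->] _ IHU]; first by rewrite mul0r; apply: lspan0.
rewrite mulrDl -scalerAl; apply: lspanD IHU; apply: lspanZ.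
elim: SY => [|b _ V [y ey ->] _ IHV]; first by rewrite mulr0; apply: lspan0.
rewrite mulrDr -scalerAr; apply: lspanD IHV; apply: lspanZ.
by apply: lspan_mem; exists (x * y); [apply: even_mul | rewrite specM].
Qed.

(** Although [g] only sees vectors over [K], the span over [R] contains products
    of arbitrary real vectors. *)
Lemma evspan_phi p p' : evspan (phi8 p * phi8 p').
Proof.
have phiE q : exists c : 'I_6 -> R, phi8 q = \sum_i c i *: (h (g (delta_mx 0 i)) : 'M[R]_8).
  exists (fun i => (q *m invmx L) 0 i).
  rewrite -{1}(mulmxKV Lu q) {1}(row_sum_delta (q *m invmx L)) mulmx_suml.
  under eq_bigr do rewrite -scalemxAl.
  by rewrite phi8_sum; apply: eq_bigr => i _; rewrite hg map_delta_mx.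
have [c ->] := phiE p; have [c' ->] := phiE p'.
rewrite mulr_suml; apply: lspan_sum => i; rewrite mulr_sumr; apply: lspan_sum => j.
rewrite -scalerAl -scalerAr; do 2!apply: lspanZ.
apply: lspan_mem; exists (g (delta_mx 0 i) * g (delta_mx 0 j)); first exact: even_pair.
by rewrite specM.
Qed.

Lemma third_ord4 (a c : 'I_4) : exists b, (b != a) && (b != c).
Proof.
have : (0 < #|~: [set a; c]|)%N.
  by rewrite cardsCs setCK card_ord subn_gt0 cards2; case: eqP.
by case/card_gt0P => b; rewrite !inE negb_or => ?; exists b.
Qed.

Lemma evspan_pair (a b : 'I_4) : a != b ->
  evspan (diag2 (delta_mx a b) (- delta_mx b a)).
Proof.
move=> /(skew_elementary R)[p [p' [E1 E2]]].
by have := evspan_phi p p'; rewrite anti2_mul E1 E2.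
Qed.

(** Products of two elements of [evspan_pair] with chained indices keep one
    block and kill the other, because the two blocks are chained in opposite
    orders. *)
Lemma evspan_off (a c : 'I_4) : a != c ->
  evspan (diag2 (delta_mx a c) 0) /\ evspan (diag2 0 (delta_mx a c)).
Proof.
move=> ac; have [b /andP[ba bc]] := third_ord4 a c.
have ab : a != b by rewrite eq_sym.
have cb : c != b by rewrite eq_sym.
split.
  have := evspan_mul (evspan_pair ab) (evspan_pair bc).
  rewrite diag2_mul mulNmx mulmxN opprK !mul_delta_mx_cond eqxx mulr1n.
  by rewrite (negPf ac) mulr0n.
have := evspan_mul (evspan_pair ba) (evspan_pair cb).
rewrite diag2_mul mulNmx mulmxN opprK !mul_delta_mx_cond eqxx mulr1n.
by rewrite (negPf ac) mulr0n.
Qed.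

Lemma evspan_delta (a c : 'I_4) :
  evspan (diag2 (delta_mx a c) 0) /\ evspan (diag2 0 (delta_mx a c)).
Proof.
have [->|] := eqVneq a c; last exact: evspan_off.
have [b /andP[bc _]] := third_ord4 c c.
have [u1 u2] := evspan_off bc; rewrite eq_sym in bc; have [v1 v2] := evspan_off bc.
split.
  by have := evspan_mul v1 u1; rewrite diag2_mul mulmx0 mul_delta_mx.
by have := evspan_mul v2 u2; rewrite diag2_mul mulmx0 mul_delta_mx.
Qed.

Lemma evspan_diag2 Y Z : evspan (diag2 Y Z).
Proof.
have -> : diag2 Y Z = diag2 Y 0 + diag2 0 Z by rewrite diag2D addr0 add0r.
have sum0 (F : 'M[R]_4 -> 'M[R]_8) W : F 0 = 0 -> {morph F : U V / U + V} ->
    (forall a i j, evspan (F (a *: delta_mx i j))) -> evspan (F W).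
  move=> F0 FD FE; rewrite (matrix_sum_delta W).
  apply: (big_ind (fun U => evspan (F U))) => [|U V EU EV|i _].
  - by rewrite F0; apply: lspan0.
  - by rewrite FD; apply: lspanD.
  apply: (big_ind (fun U => evspan (F U))) => [|U V EU EV|j _ //].
  - by rewrite F0; apply: lspan0.
  - by rewrite FD; apply: lspanD.
have d0 : diag2 0 0 = 0 :> 'M[R]_8.
  by have := @diag2_scalar R 0; rewrite !raddf0.
apply: lspanD.
  apply: (sum0 (fun W => diag2 W 0)) => // [U V|a i j]; first by rewrite diag2D addr0.
  by have := lspanZ a (evspan_delta i j).1; rewrite diag2Z scaler0.
apply: (sum0 (fun W => diag2 0 W)) => // [U V|a i j]; first by rewrite diag2D addr0.
by have := lspanZ a (evspan_delta i j).2; rewrite diag2Z scaler0.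
Qed.

(** A central element commutes with all block-diagonal matrices. *)
Lemma central_scalar x : even_part g x -> (forall y, even_part g y -> x * y = y * x) ->
  psi1 x = (psi1 x 0 0)%:M /\ psi2 x = (psi2 x 0 0)%:M.
Proof.
move=> ex xc.
have comm X : evspan X -> diag2 (psi1 x) (psi2 x) * X = X * diag2 (psi1 x) (psi2 x).
  rewrite -even_diag2 //; elim=> [|a _ U [y ey ->] _ IHU]; first by rewrite mulr0 mul0r.
  by rewrite mulrDl mulrDr IHU -scalerAl -scalerAr -!specM xc.
split; apply: comm_scalar_mx => Y.
  have := comm _ (evspan_diag2 Y 0); rewrite !diag2_mul => /(congr1 (@ul4 R)).
  by rewrite !ul4_diag2.
have := comm _ (evspan_diag2 0 Y); rewrite !diag2_mul => /(congr1 (@dr4 R)).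
by rewrite !dr4_diag2.
Qed.

End CliffordReal.

(** * The even Clifford algebra over its centre *)

Section EvenTable.
Variables (R : rcfType) (K : fieldType) (em : {rmorphism K -> R}).
Variables (A : 'M[K]_6) (C : algType K) (g : {linear 'rV[K]_6 -> C}).
Hypothesis g_cliff : is_clifford A g.
Variables (L : 'M[R]_6) (h : {lrmorphism C -> restr_mx em 7}).
Hypotheses (Lu : L \in unitmx) (hg : forall v, h (g v) = phi8 (map_mx em v *m L)).

Variable d : K.
Local Notation Qd := {poly %/ 'X^2 + d%:P}.
Variables (zeta : {lrmorphism Qd -> C}) (I : finType) (b : I -> C) (T : algtab Qd I).
Hypothesis zetaP : forall l, even_part g (zeta l) /\
  forall x, even_part g x -> zeta l * x = x * zeta l.
Hypothesis b_even : forall i, even_part g (b i).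
Hypothesis b_basis : forall x, even_part g x ->
  exists! l : {ffun I -> Qd}, x = \sum_i zeta (l i) * b i.
Hypothesis b_mul : forall i j, b i * b j = \sum_k zeta (T i j k) * b k.

Lemma cliff_sq v : exists c, g v * g v = c%:A.
Proof. by exists (quadf A v); apply: g_cliff.1. Qed.

Lemma zetaZ a x : zeta (a *: x) = a *: zeta x.
Proof. exact: linearZ. Qed.
Lemma zetaD x y : zeta (x + y) = zeta x + zeta y. Proof. exact: rmorphD. Qed.
Lemma zetaB x y : zeta (x - y) = zeta x - zeta y. Proof. exact: rmorphB. Qed.
Lemma zetaM x y : zeta (x * y) = zeta x * zeta y. Proof. exact: rmorphM. Qed.
Lemma zeta1 : zeta 1 = 1. Proof. exact: rmorph1. Qed.

Lemma zeta_b_even l i : even_part g (zeta l * b i).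
Proof. by apply: even_mul; [case: (zetaP l) | apply: b_even]. Qed.

Lemma b_free (l : {ffun I -> Qd}) : \sum_i zeta (l i) * b i = 0 -> l = 0.
Proof.
move=> l0; have [|l' [_ uniq_l]] := @b_basis 0.
  exact: even0.
rewrite -(uniq_l l) //; apply: uniq_l.
by rewrite big1 // => i _; rewrite ffunE rmorph0 mul0r.
Qed.

(** The even part is spanned by 32 monomials over [K], and each [b i] accounts
    for the two independent vectors [b i] and [zeta 'qX * b i]. *)
Lemma card_even_basis : (#|I| <= 16)%N.
Proof.
rewrite leqNgt; apply/negP => ltI.
pose l := [seq (delta_mx 0 i : 'rV[K]_6) | i <- enum 'I_6].
have lgen v : exists c : 'rV[K]_6 -> K, v = \sum_(u <- l) c u *: u.
  exists (fun u => (u *m v^T) 0 0).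
  rewrite big_map big_enum /= {1}[v]row_sum_delta; apply: eq_bigr => i _.
  by rewrite -rowE !mxE.
have sz : size (monomials g l).1 = 32%N.
  have : size l = 6%N by rewrite size_map -cardE card_ord.
  by case: l {lgen} => // u l' [sl]; rewrite size_monomials sl.
pose u (j : I * bool) := zeta (if j.2 then 'qX else 1) * b j.1.
have [j||c [[j cj] c0]] := @lspan_dep K C (I * bool)%type (monomials g l).1 u.
- by apply: (even_part_span cliff_sq lgen); apply: zeta_b_even.
- by rewrite sz card_prod card_bool; lia.
(* The two coefficients of [b i] are gathered into one of the centre. *)
pose l' : {ffun I -> Qd} := [ffun i => (c (i, false))%:A + c (i, true) *: 'qX].
have /b_free l'0 : \sum_i zeta (l' i) * b i = 0.
  rewrite -[RHS]c0 (eq_bigr (fun p : I * bool => c (p.1, p.2) *: u (p.1, p.2))); last by case.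
  rewrite -(pair_bigA _ (fun i e => c (i, e) *: u (i, e))) /=; apply: eq_bigr => i _.
  by rewrite big_bool /u /= ffunE zetaD !zetaZ mulrDl addrC -!scalerAl.
have := congr1 (fun l : {ffun I -> Qd} => l j.1) l'0; rewrite /l' !ffunE => /quad_indep[e0 e1].
by case: j cj e0 e1 => i [] /= ci e0 e1; rewrite ?e0 ?e1 eqxx in ci.
Qed.

Definition psi (s : bool) (x : C) : 'M[R]_4 := if s then psi1 h x else psi2 h x.

Lemma psiM s x y : even_part g x -> even_part g y -> psi s (x * y) = psi s x *m psi s y.
Proof.
move=> ex ey; rewrite /psi /psi1 /psi2 specM (even_diag2 hg ex) (even_diag2 hg ey).
by rewrite diag2_mul !ul4_diag2 !dr4_diag2; case: s.
Qed.

Lemma psiD s x y : psi s (x + y) = psi s x + psi s y.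
Proof.
by case: s; rewrite /psi /psi1 /psi2 rmorphD; apply/matrixP => i j; rewrite !mxE.
Qed.

Lemma psiZ s c x : psi s (c *: x) = em c *: psi s x.
Proof.
by case: s; rewrite /psi /psi1 /psi2 linearZ /=; apply/matrixP => i j; rewrite !mxE.
Qed.

Lemma psi0 s : psi s 0 = 0.
Proof. by have := psiZ s 0 0; rewrite !scale0r rmorph0 scale0r. Qed.

Lemma psi_1 s : psi s 1 = 1%:M.
Proof.
have : h 1 = diag2 1%:M 1%:M by rewrite rmorph1 diag2_scalar.
by rewrite /psi /psi1 /psi2 => ->; rewrite ul4_diag2 dr4_diag2; case: s.
Qed.

(** The value of a central element on one of the two blocks: [true] for the
    upper left one, [false] for the lower right one. *)
Definition ev s l : R := psi s (zeta l) 0 0.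

Lemma psi_zeta s l : psi s (zeta l) = (ev s l)%:M.
Proof.
have [ez cz] := zetaP l.
by have [E1 E2] := central_scalar Lu hg ez cz; rewrite /ev /psi; case: s.
Qed.

Lemma ev_zmod s : zmod_morphism (ev s).
Proof.
move=> x y; rewrite /ev zetaB -[- _ in LHS]scaleN1r psiD psiZ !mxE.
by rewrite rmorphN1 mulN1r.
Qed.

Lemma ev_monoid s : monoid_morphism (ev s).
Proof.
split=> [|x y]; first by rewrite /ev zeta1 psi_1 mxE eqxx.
rewrite {1}/ev zetaM psiM; [|by case: (zetaP x)|by case: (zetaP y)].
by rewrite !psi_zeta -scalar_mxM mxE eqxx mulr1n.
Qed.

HB.instance Definition _ s := GRing.isZmodMorphism.Build Qd R (ev s) (ev_zmod s).
HB.instance Definition _ s := GRing.isMonoidMorphism.Build Qd R (ev s) (ev_monoid s).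

(** The structure of [ev s] depends on hypotheses that unification cannot
    recover, hence a name for the bundled morphism. *)
Definition ev_rmorphism s : {rmorphism Qd -> R} := ev s.

Lemma evD s x y : ev s (x + y) = ev s x + ev s y. Proof. exact: rmorphD. Qed.
Lemma evM s x y : ev s (x * y) = ev s x * ev s y. Proof. exact: rmorphM. Qed.

Lemma ev_alg s c : ev s c%:A = em c.
Proof. by rewrite /ev zetaZ zeta1 psiZ psi_1 !mxE eqxx mulr1. Qed.

Lemma evZ s c x : ev s (c *: x) = em c * ev s x.
Proof. by rewrite -mulr_algl evM ev_alg. Qed.

Definition beta s i := psi s (b i).

Lemma psi_zeta_b s l i : psi s (zeta l * b i) = ev s l *: beta s i.
Proof.
rewrite psiM; [|by case: (zetaP l)|exact: b_even].
by rewrite psi_zeta mul_scalar_mx.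
Qed.

Lemma psi_sum s (l : I -> Qd) :
  psi s (\sum_i zeta (l i) * b i) = \sum_i ev s (l i) *: beta s i.
Proof.
rewrite (big_morph (psi s) (@psiD s) (psi0 s)).
by apply: eq_bigr => i _; rewrite psi_zeta_b.
Qed.

Lemma beta_mul s i j : beta s i *m beta s j = \sum_k ev s (T i j k) *: beta s k.
Proof. by rewrite -psiM // b_mul psi_sum. Qed.

(** The coefficients of both blocks come from the same elements of the centre,
    evaluated in two ways. *)
Lemma beta_joint X : evspan g h X -> exists r : bool -> I -> R,
  (ul4 X = \sum_i r true i *: beta true i) /\
  (dr4 X = \sum_i r false i *: beta false i) /\
  (ev true =1 ev false -> r true =1 r false).
Proof.
elim=> [|a _ U [x ex ->] _ [r [E1 [E2 Er]]]].
  by exists (fun _ _ => 0); split; [|split] => //;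
    rewrite big1; [apply/matrixP => i j; rewrite !mxE | move=> i _; rewrite scale0r |
    apply/matrixP => i j; rewrite !mxE | move=> i _; rewrite scale0r].
have [l [El _]] := b_basis ex.
exists (fun s i => a * ev s (l i) + r s i); split; [|split].
- under eq_bigr do rewrite scalerDl -scalerA.
  rewrite big_split /= -E1 -scaler_sumr -psi_sum -El.
  by apply/matrixP => i j; rewrite !mxE.
- under eq_bigr do rewrite scalerDl -scalerA.
  rewrite big_split /= -E2 -scaler_sumr -psi_sum -El.
  by apply/matrixP => i j; rewrite !mxE.
by move=> Eev i; rewrite Eev Er.
Qed.

Lemma beta_span s Y : exists r : I -> R, Y = \sum_i r i *: beta s i.
Proof.
have [r [E1 [E2 _]]] := beta_joint (evspan_diag2 Lu hg Y Y).
by exists (r s); case: s; rewrite -?E1 -?E2 ?ul4_diag2 ?dr4_diag2.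
Qed.

(** The matrices [beta s i] span a space of dimension 16, and there are at most
    16 of them. *)
Lemma beta_free s (r : I -> R) : \sum_i r i *: beta s i = 0 -> forall i, r i = 0.
Proof.
pose B := \matrix_(k < #|I|) mxvec (beta s (enum_val k)).
have rowB (c : I -> R) : (\row_k c (enum_val k)) *m B = mxvec (\sum_i c i *: beta s i).
  rewrite mulmx_sum_row linear_sum /=.
  rewrite [RHS](reindex (fun k : 'I_#|I| => enum_val k)) /=; last first.
    by exists enum_rank => j _; [exact: enum_valK | exact: enum_rankK].
  by apply: eq_bigr => k _; rewrite rowK mxE linearZ.
have fullB : row_full B.
  rewrite -sub1mx; apply/row_subP => i.
  have [c] := beta_span s (vec_mx (row i 1%:M)).
  move/(congr1 mxvec); rewrite vec_mxK -rowB => ->; exact: submxMl.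
have freeB : row_free B.
  rewrite /row_free eqn_leq rank_leq_row /=.
  by move: fullB; rewrite /row_full => /eqP ->; apply: leq_trans card_even_basis _.
move=> r0 i; have := rowB r; rewrite r0 linear0 => E.
move/eqP: E; rewrite (mulmx_free_eq0 _ freeB) => /eqP.
by move/rowP => /(_ (enum_rank i)); rewrite !mxE enum_rankK.
Qed.

(** If the two evaluations agreed, the two blocks of an element of [evspan] would
    have the same coefficients, so that one could not vanish without the
    other. *)
Lemma ev_neq : ~ (ev true =1 ev false).
Proof.
move=> Eev; have [r [E1 [E2 Er]]] := beta_joint (evspan_diag2 Lu hg 1%:M 0).
rewrite dr4_diag2 in E2; rewrite ul4_diag2 in E1.
have r0 := beta_free (esym E2).
have : 1%:M = 0 :> 'M[R]_4.
  by rewrite E1 big1 // => i _; rewrite Er // r0 scale0r.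
by move/matrixP => /(_ 0 0); rewrite !mxE eqxx => /eqP; rewrite oner_eq0.
Qed.

Lemma ev_conj : ev true 'qX = - ev false 'qX.
Proof.
have sqr s : ev s 'qX ^+ 2 = - em d by rewrite expr2 -evM quad_sqr ev_alg rmorphN.
have /eqP := sqr true; rewrite -(sqr false) eqf_sqr => /orP[/eqP E|/eqP //].
case: ev_neq => l; have [c0 [c1 ->]] := quad_decomp l.
by rewrite !evD !ev_alg !evZ E.
Qed.

(** The product of the two values is the value of the norm, which lies in the
    field [K], so it is enough that neither value is zero. *)
Lemma ev_unit (l : Qd) : ev true l != 0 -> ev false l != 0 -> exists l', l * l' = 1.
Proof.
have [c0 [c1 ->]] := quad_decomp l.
rewrite !evD !ev_alg !evZ ev_conj => l1 l2.
set w := ev false 'qX in l1 l2.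
have w2 : w ^+ 2 = - em d by rewrite expr2 /w -evM quad_sqr ev_alg rmorphN.
pose N := c0 ^+ 2 + c1 ^+ 2 * d.
have N0 : N != 0.
  have := mulf_neq0 l1 l2.
  have -> : (em c0 + em c1 * - w) * (em c0 + em c1 * w) = em N.
    by rewrite /N rmorphD !rmorphM ?rmorphXn -[em d]opprK -w2; ring.
  by rewrite fmorph_eq0.
(* The conjugate divided by the norm. *)
exists (N^-1 *: (c0%:A - c1%:A * 'qX)).
rewrite -scalerAr -(mulr_algl c1 ('qX : Qd)).
have -> : (c0%:A + c1%:A * 'qX) * (c0%:A - c1%:A * 'qX) = N%:A :> Qd.
  have -> : N%:A = (c0%:A ^+ 2 + c1%:A ^+ 2 * d%:A) :> Qd.
    by rewrite -[LHS]/(in_alg Qd N) rmorphD rmorphM !expr2 !rmorphM.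
  by rewrite -[d%:A]opprK -scaleNr -quad_sqr; ring.
by rewrite scalerA mulVf // scale1r.
Qed.

(** The algebra given by the table, embedded in the Clifford algebra, from which
    it inherits associativity and the unit. *)
Definition embC (x : {ffun I -> Qd^o}) : C := \sum_i zeta (x i) * b i.

Lemma embC_inj : injective embC.
Proof.
move=> x y xy; apply/eqP; rewrite -subr_eq0; apply/eqP.
apply: (@b_free (x - y)); apply/eqP.
rewrite (eq_bigr (fun i => zeta (x i) * b i - zeta (y i) * b i)); last first.
  by move=> i _; rewrite !ffunE zetaB mulrBl.
by rewrite sumrB subr_eq0; apply/eqP.
Qed.

Lemma zeta_sum (J : finType) (F : J -> Qd) : zeta (\sum_j F j) = \sum_j zeta (F j).
Proof. exact: rmorph_sum. Qed.

Lemma embC_mul x y : embC (tmul T x y) = embC x * embC y.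
Proof.
rewrite /embC mulr_suml.
under eq_bigr do rewrite ffunE zeta_sum mulr_suml.
rewrite exchange_big; apply: eq_bigr => i _ /=.
rewrite mulr_sumr.
under eq_bigr do rewrite zeta_sum mulr_suml.
rewrite exchange_big; apply: eq_bigr => j _ /=.
have [_ cz] := zetaP (y j).
rewrite mulrA -(mulrA (zeta (x i))) -cz // mulrA -mulrA b_mul mulr_sumr.
by apply: eq_bigr => k _; rewrite !zetaM !mulrA.
Qed.

Lemma tab_assoc x y z : tmul T x (tmul T y z) = tmul T (tmul T x y) z.
Proof. by apply: embC_inj; rewrite !embC_mul mulrA. Qed.

Lemma tab_unit : exists u : {ffun I -> Qd^o}, forall x, tmul T u x = x /\ tmul T x u = x.
Proof.
have [u [/esym u1 _]] := b_basis (even1 g); exists u => x.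
by split; apply: embC_inj; rewrite embC_mul [embC u]u1 ?mul1r ?mulr1.
Qed.

Lemma tab_nonempty : (0 < #|I|)%N.
Proof.
rewrite lt0n; apply/eqP => I0; have [u [u1 _]] := b_basis (even1 g).
move/eqP: u1; rewrite big1 ?oner_eq0 // => i _.
by have := card0_eq I0 i.
Qed.

Definition sandwich (p q : I * I) : Qd := \sum_m T p.1 q.1 m * T m p.2 q.2.

(** The matrix of [a (x) b |-> (x |-> a x b)], whose invertibility is the
    Azumaya condition. *)
Definition sandwich_mx : 'M[Qd]_#|{: I * I}| :=
  \matrix_(p, q) sandwich (enum_val p) (enum_val q).

Lemma sum_enum_val (J : finType) (V : nmodType) (F : J -> V) :
  \sum_j F j = \sum_(k < #|J|) F (enum_val k).
Proof.
rewrite (reindex (fun k : 'I_#|J| => enum_val k)) //=.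
by exists enum_rank => j _; [exact: enum_valK | exact: enum_rankK].
Qed.

Lemma mul_delta_entry (X Z : 'M[R]_4) i j k l :
  (X *m delta_mx i j *m Z) k l = X k i * Z j l.
Proof.
have E j' : (X *m delta_mx i j) k j' = X k i *+ (j' == j).
  rewrite mxE (bigD1 i) //= mxE eqxx /= mulr_natr big1 ?addr0 // => i' /negPf ni.
  by rewrite mxE ni mulr0.
rewrite mxE (bigD1 j) //= E eqxx mulr1n big1 ?addr0 // => j' /negPf nj.
by rewrite E nj mulr0n mul0r.
Qed.

(** The maps [Y |-> beta s i * Y * beta s j] are linearly independent because
    the [beta s i] form a basis: apply them to elementary matrices and compare
    entries, first for [j], then for [i]. *)
Lemma beta_sandwich_free s (r : I * I -> R) :
  (forall k, \sum_p r p *: (beta s p.1 *m beta s k *m beta s p.2) = 0) ->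
  forall p, r p = 0.
Proof.
move=> rk.
have rY Y : \sum_p r p *: (beta s p.1 *m Y *m beta s p.2) = 0.
  have [c ->] := beta_span s Y.
  under eq_bigr do rewrite mulmx_sumr mulmx_suml scaler_sumr.
  rewrite exchange_big big1 //= => k _.
  rewrite -[RHS](scaler0 _ (c k)) -[in RHS](rk k) scaler_sumr; apply: eq_bigr => p _.
  by rewrite -scalemxAr -scalemxAl scalerA mulrC -scalerA.
case=> i j.
have rij a a' : \sum_i r (i, j) * beta s i a a' = 0.
  apply: (beta_free (s := s) (r := fun j => \sum_i r (i, j) * beta s i a a')).
  apply/matrixP => x y; have /matrixP/(_ a y) := rY (delta_mx a' x).
  rewrite summxE mxE => E; rewrite summxE mxE -[RHS]E.
  rewrite [RHS](eq_bigr (fun p => r (p.1, p.2) * (beta s p.1 a a' * beta s p.2 x y))).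
    rewrite -(pair_bigA _ (fun i j => r (i, j) * (beta s i a a' * beta s j x y))).
    rewrite exchange_big /=; apply: eq_bigr => j' _.
    by rewrite mxE mulr_suml; apply: eq_bigr => i' _; rewrite mulrA.
  by case=> i' j' _; rewrite mxE mul_delta_entry.
apply: (beta_free (s := s) (r := fun i => r (i, j))).
by apply/matrixP => x y; rewrite summxE mxE -[RHS](rij x y); apply: eq_bigr => i' _; rewrite mxE.
Qed.

Lemma sandwich_det s : ev s (\det sandwich_mx) != 0.
Proof.
rewrite -det_map_mx; apply/det0P => -[v vn0 v0].
case/rV0Pn: vn0 => k; case/negP; apply/eqP.
(* A row of the kernel gives a dependence between the sandwich maps. *)
pose r p := v 0 (enum_rank p).
rewrite -[v 0 k]/(v 0 k) -(enum_valK k) -/(r (enum_val k)).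
apply: (beta_sandwich_free (s := s)) => {}k.
have E p : beta s p.1 *m beta s k *m beta s p.2 =
    \sum_l ev s (sandwich p (k, l)) *: beta s l.
  rewrite beta_mul mulmx_suml.
  under eq_bigr do rewrite -scalemxAl beta_mul scaler_sumr.
  rewrite exchange_big; apply: eq_bigr => l _ /=.
  under eq_bigr do rewrite scalerA -evM.
  by rewrite -scaler_suml; congr (_ *: _); rewrite /sandwich /= [RHS]rmorph_sum.
under eq_bigr do rewrite E scaler_sumr.
rewrite exchange_big big1 //= => l _.
under eq_bigr do rewrite scalerA.
rewrite -scaler_suml; suff -> : \sum_p r p * ev s (sandwich p (k, l)) = 0 by rewrite scale0r.
move/rowP: v0 => /(_ (enum_rank (k, l))); rewrite [RHS]mxE => {2}<-.
rewrite mxE sum_enum_val; apply: eq_bigr => p _.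
by rewrite /r enum_valK !mxE enum_rankK.
Qed.

(** The determinant of [sandwich_mx] has nonzero value under both evaluations,
    so it is invertible. *)
Lemma tab_azumaya (O : Qd -> Prop) : (forall x, O x) -> azumaya O T.
Proof.
move=> Oall; split=> //; first exact: tab_nonempty.
- exact: tab_assoc.
- by have [u Hu] := tab_unit; exists u.
move=> phi _.
have [e de] := ev_unit (sandwich_det true) (sandwich_det false).
pose G := sandwich_mx.
have Gl : G *m (e *: \adj G) = 1%:M.
  by rewrite -scalemxAr mul_mx_adj -mul_scalar_mx -scalar_mxM mulrC de.
have Gr : (e *: \adj G) *m G = 1%:M.
  by rewrite -scalemxAl mul_adj_mx -mul_scalar_mx -scalar_mxM mulrC de.
pose rowof (c : {ffun I * I -> Qd}) : 'rV[Qd]_#|{: I * I}| := \row_p c (enum_val p).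
have eqE (c : {ffun I * I -> Qd}) :
    (forall k l, \sum_i \sum_j c (i, j) * (\sum_m T i k m * T m j l) = phi (k, l)) <->
    rowof c *m G = rowof phi.
  have sE k l : (rowof c *m G) 0 (enum_rank (k, l)) =
      \sum_i \sum_j c (i, j) * (\sum_m T i k m * T m j l).
    rewrite pair_bigA mxE /= [RHS]sum_enum_val; apply: eq_bigr => p _.
    rewrite !mxE enum_rankK /sandwich.
    by case: (enum_val p).
  split=> [H|H k l].
    apply/rowP => q; rewrite -(enum_valK q) [RHS]mxE enum_rankK.
    by case: (enum_val q) => k l; rewrite sE H.
  by rewrite -sE H mxE enum_rankK.
have rowof_inj : injective rowof.
  move=> c c' /rowP H; apply/ffunP => p; have := H (enum_rank p).
  by rewrite !mxE enum_rankK.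
exists [ffun p => (rowof phi *m (e *: \adj G)) 0 (enum_rank p)]; split.
  split=> //; apply/eqE; rewrite -[RHS]mulmx1 -Gr mulmxA; congr (_ *m _).
  by apply/rowP => q; rewrite mxE ffunE enum_valK.
move=> c [_ /eqE H]; apply: rowof_inj; rewrite -[RHS]mulmx1 -Gl mulmxA H.
by apply/rowP => q; rewrite mxE ffunE enum_valK.
Qed.

(** The basis [beta s] identifies the evaluated table with 4 x 4 matrices. *)
Lemma tab_split s : brauer_equiv (fun i j k => ev s (T i j k)) (base_alg R).
Proof.
exists 0%N, 3%N.
pose o1 : 'I_1 * 'I_1 := (ord0, ord0).
have o1P (p : 'I_1 * 'I_1) : p = o1 by case: p => p q; rewrite !ord1.
have sumI (F : I * ('I_1 * 'I_1) -> R) : \sum_p F p = \sum_i F (i, o1).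
  rewrite [LHS](eq_bigr (fun p => F (p.1, p.2))); last by case.
  rewrite -(pair_bigA _ (fun i p => F (i, p))) /=; apply: eq_bigr => i _.
  by rewrite (big_pred1 o1) // => p; rewrite /= (o1P p) eqxx.
have sumM (F : unit * ('I_4 * 'I_4) -> R) : \sum_q F q = \sum_a \sum_c F (tt, (a, c)).
  rewrite [LHS](eq_bigr (fun q => F (q.1, q.2))); last by case.
  rewrite -(pair_bigA _ (fun u p => F (u, p))) /= (big_pred1 tt); last by case.
  by rewrite pair_bigA; apply: eq_bigr => -[].
pose mxof (x : {ffun I * ('I_1 * 'I_1) -> R^o}) : 'M[R]_4 := \sum_i x (i, o1) *: beta s i.
pose f (x : {ffun I * ('I_1 * 'I_1) -> R^o}) : {ffun unit * ('I_4 * 'I_4) -> R^o} :=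
  [ffun q => mxof x q.2.1 q.2.2].
have mxof_lin a x y : mxof (a *: x + y) = a *: mxof x + mxof y.
  rewrite /mxof scaler_sumr -big_split; apply: eq_bigr => i _.
  by rewrite !ffunE scalerDl scalerA.
have f_lin : linear f.
  by move=> a x y; apply/ffunP => q; rewrite !ffunE mxof_lin !mxE.
pose fL := GRing.isLinear.Build R _ _ _ f f_lin.
pose F : {linear {ffun I * ('I_1 * 'I_1) -> R^o} -> {ffun unit * ('I_4 * 'I_4) -> R^o}} :=
  HB.pack f fL.
exists F; split; last first.
  move=> x y; rewrite -[LHS]/(f _) -[F x]/(f x) -[F y]/(f y).
  have mxofM : mxof (tmul (tens (fun i j k => ev s (T i j k)) (@mat_alg R 1)) x y)
      = mxof x *m mxof y.
    rewrite /mxof mulmx_suml.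
    under eq_bigr do rewrite ffunE sumI scaler_suml.
    rewrite exchange_big; apply: eq_bigr => i _ /=.
    rewrite mulmx_sumr.
    under eq_bigr do rewrite sumI scaler_suml.
    rewrite exchange_big; apply: eq_bigr => j _ /=.
    rewrite -scalemxAr -scalemxAl beta_mul scalerA scaler_sumr.
    apply: eq_bigr => k _; rewrite scalerA /tens /mat_alg /= mulr1.
    by rewrite [y _ * x _]mulrC.
  apply/ffunP => -[[] [a c]]; rewrite ffunE mxofM /= !ffunE !mxE sumM.
  rewrite [RHS](bigD1 a) //= [X in _ = _ + X]big1 ?addr0; last first.
    move=> a' /negPf na; rewrite big1 // => k _; rewrite sumM big1 // => k' _.
    rewrite big1 // => c' _; rewrite /tens /mat_alg /= [a == a']eq_sym na andbF mulr0.
    by rewrite mulr0.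
  apply: eq_bigr => k _; rewrite sumM [RHS](bigD1 k) //= [X in _ = _ + X]big1 ?addr0; last first.
    move=> k' /negPf nk; rewrite big1 // => c' _.
    by rewrite /tens /mat_alg /= [k == k']eq_sym nk mulr0 mulr0.
  rewrite [RHS](bigD1 c) //= [X in _ = _ + X]big1 ?addr0; last first.
    move=> c' /negPf nc.
    by rewrite /tens /mat_alg /= [c == c']eq_sym nc !andbF mulr0 mulr0.
  by rewrite /tens /mat_alg /base_alg /= !eqxx /= !ffunE !mulr1.
have /choice[r Hr] Y : exists r : I -> R, Y = \sum_i r i *: beta s i by apply: beta_span.
pose f' (y : {ffun unit * ('I_4 * 'I_4) -> R^o}) : {ffun I * ('I_1 * 'I_1) -> R^o} :=
  [ffun p => r (\matrix_(a, c) y (tt, (a, c))) p.1].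
have mxof_f' y : mxof (f' y) = \matrix_(a, c) y (tt, (a, c)).
  by rewrite [RHS]Hr; apply: eq_bigr => i _; rewrite ffunE.
have fK : cancel f' f.
  by move=> y; apply/ffunP => -[[] [a c]]; rewrite ffunE mxof_f' mxE.
exists f' => // x; apply/ffunP => -[i p]; rewrite (o1P p).
have : mxof (f' (f x)) = mxof x.
  by rewrite mxof_f'; apply/matrixP => a c; rewrite mxE ffunE.
move/eqP; rewrite -subr_eq0 /mxof -sumrB => /eqP H.
have {}H : \sum_i (f' (f x) (i, o1) - x (i, o1)) *: beta s i = 0.
  by rewrite -[RHS]H; apply: eq_bigr => k _; rewrite scalerBl.
by apply/eqP; rewrite -subr_eq0; apply/eqP; apply: (beta_free H).
Qed.

End EvenTable.

(** * Regular functions at a generic point *)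

Lemma brauer_refl (K : comNzRingType) (I : finType) (T : algtab K I) : brauer_equiv T T.
Proof.
exists 0%N, 0%N.
exists (idfun : {linear {ffun I * ('I_1 * 'I_1) -> K^o} -> {ffun I * ('I_1 * 'I_1) -> K^o}}).
by split=> //; exists idfun.
Qed.

Section WeightedHomogeneous.

Lemma whomogC c : whomog 0 c%:MP.
Proof.
move=> m; rewrite msuppC; case: ifP => // _; rewrite inE => /eqP ->.
by rewrite big1 // => i _; rewrite mnm0E muln0.
Qed.

Lemma whomogX (i : 'I_4) : whomog (nth 0%N [:: 1; 1; 1; 3]%N i) 'X_i.
Proof.
move=> m; rewrite msuppX inE => /eqP ->.
rewrite (bigD1 i) //= mnm1E eqxx muln1 big1 ?addn0 // => j /negPf ji.
by rewrite mnm1E eq_sym ji muln0.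
Qed.

Lemma whomogD d p q : whomog d p -> whomog d q -> whomog d (p + q).
Proof. by move=> hp hq m /msuppD_le; rewrite mem_cat => /orP[/hp|/hq]. Qed.

Lemma whomogM d d' p q : whomog d p -> whomog d' q -> whomog (d + d') (p * q).
Proof.
move=> hp hq m /msuppM_le /allpairsP[[m1 m2] /= [/hp <- /hq <- ->]].
by rewrite -big_split; apply: eq_bigr => i _; rewrite mnmDE mulnDr.
Qed.

Variables (S : comNzRingType) (R : fieldType) (G : {rmorphism {mpoly rat[4]} -> S}).
Variable (evt : {rmorphism S -> R}).
Hypothesis G2 : G 'X_(2%:R) = 1.

(** Regularity at a point, with an arbitrary ring [S] in place of the function
    field and the point given by [evt]. *)
Definition regular f := exists (d : nat) (a b : {mpoly rat[4]}),
  [/\ whomog d a, whomog d b, evt (G b) != 0 & f * G b = G a].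

Lemma regularD f f' : regular f -> regular f' -> regular (f + f').
Proof.
move=> [d [a [b [ha hb bP E]]]] [d' [a' [b' [ha' hb' bP' E']]]].
exists (d + d')%N, (a * b' + a' * b), (b * b'); split.
- by apply: whomogD; [apply: whomogM | rewrite addnC; apply: whomogM].
- exact: whomogM.
- by rewrite !rmorphM mulf_neq0.
by rewrite !rmorphD !rmorphM -E -E'; ring.
Qed.

Lemma regularM f f' : regular f -> regular f' -> regular (f * f').
Proof.
move=> [d [a [b [ha hb bP E]]]] [d' [a' [b' [ha' hb' bP' E']]]].
exists (d + d')%N, (a * a'), (b * b'); split; try exact: whomogM.
- by rewrite !rmorphM mulf_neq0.
by rewrite !rmorphM -E -E'; ring.
Qed.

Lemma regular_const c : regular (G c%:MP).
Proof.
exists 0%N, c%:MP, 1%:MP; split; try exact: whomogC.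
  by rewrite mpolyC1 !rmorph1 oner_eq0.
by rewrite mpolyC1 rmorph1 mulr1.
Qed.

Lemma regular_var (i : 'I_4) : regular (G 'X_i).
Proof.
exists (nth 0%N [:: 1; 1; 1; 3]%N i), 'X_i, ('X_(2%:R) ^+ nth 0%N [:: 1; 1; 1; 3]%N i).
split; first exact: whomogX.
- elim: (nth _ _ _) => [|k IHk]; first by rewrite expr0 -mpolyC1; apply: whomogC.
  by rewrite exprS -add1n; apply: whomogM => //; apply: (@whomogX 2%:R).
- by rewrite rmorphXn G2 expr1n rmorph1 oner_eq0.
by rewrite rmorphXn G2 expr1n mulr1.
Qed.

Lemma regular_inv f f' : f * f' = 1 -> regular f -> regular f'.
Proof.
move=> ff' [d [a [b [ha hb bP E]]]]; exists d, b, a; split=> //.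
  rewrite -E rmorphM mulf_neq0 //.
  apply/eqP => f0; have := congr1 evt ff'; rewrite rmorphM f0 mul0r rmorph1.
  by move/esym/eqP; rewrite oner_eq0.
by rewrite -E mulrA [f' * f]mulrC ff' mul1r.
Qed.

Lemma regular_value f : regular f -> exists (d : nat) (a b : {mpoly rat[4]}),
  [/\ whomog d a, whomog d b, evt (G b) != 0, f * G b = G a &
    evt f = evt (G a) / evt (G b)].
Proof.
move=> [d [a [b [ha hb bP E]]]]; exists d, a, b; split=> //.
by apply: (canRL (mulfK bP)); rewrite -rmorphM E.
Qed.

End WeightedHomogeneous.

Definition rat_QP2 : {rmorphism rat -> QP2} :=
  (@tofrac {mpoly rat[2]} : {rmorphism {mpoly rat[2]} -> QP2}) \o @mpolyC 2 rat.

Section Regularity.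
Variables (R : realType) (M : 'I_3 -> 'M[rat]_6) (evt : {rmorphism funS M -> R}).

(** Evaluations of the function field with real values are real points of [S]:
    the coordinates are the values of the coordinate functions. *)
Definition real_pt : 'rV[R]_4 := \row_i evt (gen_point M 0 i).

Definition rat_funS : {rmorphism rat -> funS M} := in_alg (funS M) \o rat_QP2.

Lemma evalp_gen p : evalp (gen_point M) p = mmap rat_funS (gen_point M 0) p.
Proof. by apply: eq_mmap => // c; rewrite (fmorph_eq_rat rat_funS). Qed.

Lemma evalp_real p : evalp real_pt p = evt (mmap rat_funS (gen_point M 0) p).
Proof.
rewrite mmap_comp; apply: eq_mmap => [c|i]; last by rewrite mxE.
by rewrite -(fmorph_eq_rat (evt \o rat_funS)).
Qed.

Lemma gen_pointE : [/\ gen_point M 0 0 = QP2_s%:A, gen_point M 0 1 = QP2_t%:A,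
  gen_point M 0 2%:R = 1 & gen_point M 0 3%:R = 'qX].
Proof. by rewrite !mxE. Qed.

Lemma real_pt_on_S : real_point M real_pt.
Proof.
have [g0 g1 g2 g3] := gen_pointE.
split.
  apply/eqP => /rowP/(_ 2%:R); rewrite !mxE /= rmorph1 => /eqP.
  by rewrite oner_eq0.
rewrite evalp_real mmap_eqn g0 g1 g2 g3.
suff -> : gram_at rat_funS M QP2_s%:A QP2_t%:A 1 = map_mx (in_alg (funS M)) (gram_gen M).
  by rewrite det_map_mx expr2 quad_sqr scaleNr addNr rmorph0.
rewrite map_gram /= scale1r; apply: eq_gram => c /=.
by rewrite -(fmorph_eq_rat rat_QP2).
Qed.

Definition gen_eval : {rmorphism {mpoly rat[4]} -> funS M} := mmap rat_funS (gen_point M 0).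

Lemma gen_eval_var i : gen_eval 'X_i = gen_point M 0 i.
Proof. exact: mmap_var. Qed.

Lemma gen_eval2 : gen_eval 'X_(2%:R) = 1.
Proof. by rewrite gen_eval_var; have [] := gen_pointE. Qed.

Lemma gen_evalC c : gen_eval c%:MP = rat_funS c.
Proof. exact: mmapC. Qed.

Local Notation reg := (regular gen_eval evt).

Lemma regular_poly (p : {mpoly rat[2]}) : reg (tofrac p : QP2)%:A.
Proof.
elim/mpoly_alg_ind: p => [c|i|p q|p q].
- by rewrite -[_%:A]gen_evalC; apply: regular_const.
- have [g0 g1 _ _] := gen_pointE.
  have [->|->] : i = 0 \/ i = 1.
    by case: i => [[|[|//]]] i2; [left|right]; apply: val_inj.
  + by rewrite -[_%:A]g0 -gen_eval_var; apply: regular_var gen_eval2 _.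
  + by rewrite -[_%:A]g1 -gen_eval_var; apply: regular_var gen_eval2 _.
- by rewrite tofracD scalerDl; apply: regularD.
by rewrite tofracM -[X in _ -> _ -> reg X]/(in_alg (funS M) _) rmorphM; apply: regularM.
Qed.

Lemma regular_frac (c : QP2) : reg c%:A.
Proof.
have [n [d [dn0 E]]] := frac_quot c.
have dF : tofrac d != 0 by rewrite tofrac_eq0.
have iM (u v : QP2) : (u * v)%:A = u%:A * v%:A :> funS M.
  exact: (rmorphM (in_alg (funS M))).
have -> : c = tofrac n * (tofrac d)^-1 by rewrite -E mulfK.
rewrite iM; apply: regularM (regular_poly n) _.
by apply: regular_inv (regular_poly d); rewrite -iM mulfV // scale1r.
Qed.

(** The only denominators are polynomials in [s] and [t], and they do not vanish
    at [P] because [evt] is defined on the whole function field. *)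
Lemma regular_all f : reg f.
Proof.
have [_ _ _ g3] := gen_pointE.
have [c0 [c1 ->]] := quad_decomp f.
rewrite -(mulr_algl c1 ('qX : funS M)); apply: regularD (regular_frac c0) _.
apply: regularM (regular_frac c1) _.
by rewrite -g3 -gen_eval_var; apply: regular_var gen_eval2 _.
Qed.

Lemma regular_valP f : regular_val real_pt f (evt f).
Proof.
have [d [a [b [ha hb bP E Ev]]]] := regular_value (regular_all f).
exists d, a, b; rewrite !evalp_real !evalp_gen.
by split.
Qed.

End Regularity.

Theorem corollary26 (R : realType) (M : 'I_3 -> 'M[rat]_6)
    (M_sym : forall i, (M i)^T = M i)
    (X_smooth : smooth_X R M) (S_smooth : smooth_S R M)
    (I : finType) (alpha : algtab (funS M) I)
    (alphaP : even_clifford_tab alpha)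
    (S_real : exists P : 'rV[R]_4, real_point M P) :
  exists P : 'rV[R]_4, real_point M P /\
    exists (J : finType) (B : algtab R J),
      brauer_value P alpha B /\ inv_infty B = 0.
Proof.
have [x [y xyP]] := split_sign_affine M_sym S_smooth.
(* Openness in [s] for fixed [y], then in [t] for the chosen [s]. *)
have [s [t [stP indep]]] : exists s t : R, split_sign (netR M s t 1) /\ alg_indep s t.
  apply: (@alg_indep_near R x y (fun s t => split_sign (netR M s t 1))) => [|s sP].
    have BE u : mx_at (netP M 'X y%:P 1%:P) u = netR M u y 1.
      by rewrite netP_at !hornerE.
    have := @split_sign_near R _ x (netP_sym M_sym 'X y%:P 1%:P).
    by rewrite BE => /(_ xyP); apply: near_mono => u; rewrite BE.
  have BE u : mx_at (netP M s%:P 'X 1%:P) u = netR M s u 1.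
    by rewrite netP_at !hornerE.
  have := @split_sign_near R _ y (netP_sym M_sym s%:P 'X 1%:P).
  by rewrite BE => /(_ sP); apply: near_mono => u; rewrite BE.
pose e : {rmorphism {mpoly rat[2]} -> R} := mmap (ratr : rat -> R) (pair_pt s t).
have [em emE] := @frac_extend _ _ e indep.
have em_gram : map_mx em (gram_gen M) = netR M s t 1.
  rewrite map_gram /QP2_s /QP2_t !emE /e /= !mmap_var rmorph1; apply: eq_gram => c.
  rewrite /= -(fmorph_eq_rat rat_QP2 c); exact: (fmorph_eq_rat (em \o rat_QP2) c).
have [C [g [zeta [b [g_cliff zetaP b_even b_basis b_mul]]]]] := alphaP.
have A_split : split_sign (map_mx em (gram_gen M)) by rewrite em_gram.
have [L [h [Lu hg]]] := clifford_real A_split g_cliff.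
(* [P] is the point seen by the upper left block, whichever sign of [w] this is. *)
pose evt : {rmorphism funS M -> R} := ev_rmorphism Lu hg zetaP true.
exists (real_pt evt); split; first exact: real_pt_on_S.
have reg f : regular_val (real_pt evt) f (evt f).
  exact: regular_valP.
exists I, (fun i j k => evt (alpha i j k)); split.
  exists alpha; split=> [||i j k]; last exact: reg.
    apply: (tab_azumaya g_cliff Lu hg zetaP b_even b_basis b_mul) => f.
    by exists (evt f); apply: reg.
  exact: brauer_refl.
rewrite /inv_infty; case: asboolP => // -[].
exact: (tab_split g_cliff Lu hg zetaP b_even b_basis b_mul true).
Qed.
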